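(* For every integer $r\ge1$ and every connected constraint graph $H$ with at least one edge, there exists an activity vector $\lambda$ on $H$ for which there is exactly one simple, invariant Gibbs measure for $\lambda$ on $\hom(\mathbb{T}^r,H)$.
   Context: A constraint graph $H$ is a finite graph with node set $\{1,\dots,q\}$, possibly with loops but no multiple edges. $\mathbb{T}^r$ is the infinite connected cycle-free graph with all degrees $r+1$. $\hom(G,H)$ is the set of graph homomorphisms from the board $G$ to $H$, with the product $\sigma$-algebra. An activity vector is $\lambda=(\lambda_1,\dots,\lambda_q)$ with all $\lambda_i>0$; for finite $G$ the $\lambda$-measure on $\hom(G,H)$ gives $\varphi$ probability proportional to $\prod_v\lambda_{\varphi(v)}$. A patch is a finite set $U$ of sites, $\partial U$ the set of sites outside $U$ adjacent to $U$, $U^+=U\cup\partial U$. A probability measure $\mu$ on $\hom(G,H)$ is a Gibbs measure for $\lambda$ if for every patch $U$ and $\mu$-a.e. $\psi$, the $\mu$-conditional probability that $\varphi|_U=\psi|_U$ given $\varphi|_{G\setminus U}=\psi|_{G\setminus U}$ equals the $\lambda$-measure (on $\hom(U^+,H)$) conditional probability that $\varphi|_U=\psi|_U$ given $\varphi|_{\partial U}=\psi|_{\partial U}$. A Gibbs measure on $\hom(T,H)$, $T$ a tree, is simple if for every site $u$ and node $i$, the restrictions of $\varphi$ to the components of $T\setminus\{u\}$ are mutually independent given $\varphi(u)=i$; a measure is invariant if it is preserved by every automorphism of the board acting by precomposition. *)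

(* Defs.v *)
From HB Require Import structures.
From mathcomp Require Import all_boot all_order all_algebra finmap.
From mathcomp Require Import all_classical all_reals all_analysis.
Set Implicit Arguments.
Unset Strict Implicit.
Unset Printing Implicit Defensive.
Import Order.TTheory GRing.Theory Num.Theory.
Local Open Scope classical_set_scope.
Local Open Scope ring_scope.

(* Sites of T^r: reduced words over the alphabet 'I_(r+1) (no two consecutive
   equal letters), i.e. the Cayley graph of the free product of r+1 copies of
   Z/2Z.  Every site has exactly r+1 neighbours and the graph is connected and
   cycle-free, so this is the (r+1)-regular tree T^r. *)
Definition reducedw (r : nat) (s : seq 'I_r.+1) : bool :=
  sorted (fun a b => a != b) s.

Definition site (r : nat) := {s : seq 'I_r.+1 | reducedw s}.
HB.instance Definition _ r := Countable.on (site r).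

Definition child r (u v : site r) : bool :=
  (size (val v) == (size (val u)).+1) && (val u == take (size (val u)) (val v)).

Definition tadj r (u v : site r) : bool := child u v || child v u.

Definition tree_aut r (g : site r -> site r) : Prop :=
  bijective g /\ forall x y, tadj (g x) (g y) = tadj x y.

(* The constraint graph H has node set 'I_(n+1) (i.e. q = n+1 >= 1) and
   (symmetric) edge relation h. *)
Definition cfg (r n : nat) := site r -> 'I_n.+1.
HB.instance Definition _ r n := Choice.on (cfg r n).
HB.instance Definition _ r n := isPointed.Build (cfg r n) (fun _ => ord0).

Definition cyl_on r n (S : set (site r)) : set (set (cfg r n)) :=
  [set A | exists v i, S v /\ A = [set phi : cfg r n | phi v = i]].

Definition Cfg r n := g_sigma_algebraType (@cyl_on r n setT).

Definition is_hom r n (h : rel 'I_n.+1) (phi : site r -> 'I_n.+1) : Prop :=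
  forall u v, tadj u v -> h (phi u) (phi v).

(* hom(T^r,H) as a subset of the configuration space; a probability measure on
   hom(T^r,H) (with the trace of the product sigma-algebra) is a probability
   measure on Cfg giving full mass to this set. *)
Definition homset r n (h : rel 'I_n.+1) : set (Cfg r n) := [set phi | is_hom h phi].

Definition bdry r (U : {fset site r}) : set (site r) :=
  [set v | v \notin U /\ exists2 u, u \in U & tadj u v].
Definition Uplus r (U : {fset site r}) : set (site r) :=
  [set v | v \in U] `|` bdry U.

Definition glue r n (U : {fset site r}) (xi : {ffun U -> 'I_n.+1})
  (psi : site r -> 'I_n.+1) : site r -> 'I_n.+1 :=
  fun v => match (insub v : option U) with Some u => xi u | None => psi v end.

Section LambdaMeasure.
Variables (R : realType) (r n : nat) (h : rel 'I_n.+1) (lam : 'I_n.+1 -> R).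

Definition hom_on (U : {fset site r}) (phi : site r -> 'I_n.+1) : Prop :=
  forall u v, Uplus U u -> Uplus U v -> tadj u v -> h (phi u) (phi v).

Definition lam_wt (U : {fset site r}) (phi : site r -> 'I_n.+1) : R :=
  (if `[< hom_on U phi >] then 1 else 0) *
  \big[*%R/1]_(v \in Uplus U) lam (phi v).

(* lambda-measure (on hom(U^+,H)) conditional probability that the
   configuration on U equals eta, given that it equals psi on dU *)
Definition lam_cond (U : {fset site r}) (eta : {ffun U -> 'I_n.+1})
  (psi : site r -> 'I_n.+1) : R :=
  lam_wt U (glue eta psi) / \sum_(xi : {ffun U -> 'I_n.+1}) lam_wt U (glue xi psi).

Local Open Scope ereal_scope.

(* Gibbs measure for lambda on hom(T^r,H): for every patch U, the conditional
   probability of {phi|_U = eta} given the sigma-algebra generated by the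
   coordinates outside U is (a.s.) the lambda-conditional probability. *)
Definition is_gibbs (mu : probability (Cfg r n) R) : Prop :=
  mu (homset h) = 1 /\
  forall (U : {fset site r}) (eta : {ffun U -> 'I_n.+1}) (B : set (Cfg r n)),
    <<s @cyl_on r n (~` [set v | v \in U]) >> B ->
    mu ([set phi : Cfg r n | forall u : U, phi (val u) = eta u] `&` B) =
      \int[mu]_(phi in B) (lam_cond eta phi)%:E.

End LambdaMeasure.

Definition avoid_conn r (u x y : site r) : Prop :=
  exists p : seq (site r), [/\ path (@tadj r) x p, last x p = y &
                             all (fun z => z != u) (x :: p)].

Definition component r (u : site r) (C : set (site r)) : Prop :=
  exists x, x != u /\ C = [set y | avoid_conn u x y].

Section SimpleInvariant.
Variables (R : realType) (r n : nat).

Definition cprob (mu : probability (Cfg r n) R) (A C : set (Cfg r n)) : R :=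
  fine (mu (A `&` C)) / fine (mu C).

Definition is_simple (mu : probability (Cfg r n) R) : Prop :=
  forall (u : site r) (i : 'I_n.+1) (k : nat)
         (C : 'I_k -> set (site r)) (B : 'I_k -> set (Cfg r n)),
    injective C -> (forall j, component u (C j)) ->
    (forall j, <<s @cyl_on r n (C j) >> (B j)) ->
    (0 < mu [set phi : Cfg r n | phi u = i])%E ->
    cprob mu (\bigcap_j B j) [set phi | phi u = i] =
      \prod_(j < k) cprob mu (B j) [set phi | phi u = i].

Definition is_invariant (mu : probability (Cfg r n) R) : Prop :=
  forall g : site r -> site r, tree_aut g ->
  forall A : set (Cfg r n), measurable A ->
    mu [set phi : Cfg r n | A (phi \o g)] = mu A.

End SimpleInvariant.

(* Main.v *)
(* A simple invariant measure is a Markov chain indexed by the tree, hence is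
   determined by the law [M] of the pair of values at the two ends of an edge,
   a symmetric matrix.  Comparing the Gibbs condition at one site with the
   Markov property, for neighbours that all have value [j], shows that
   [M i j] is proportional to [g i * g j] on edges of [H], where
   [g i = kap * lam i * (A g) i ^ r] and [A] is the adjacency matrix of [H];
   conversely every positive solution [g] gives a simple invariant Gibbs
   measure.  So it suffices to find [lam] for which [g] is unique up to scaling.

   Fix a loop of [H], or an edge if [H] has no loop, and let [lam] decrease fast
   with the distance to it.  A maximal coordinate of a solution must then lie on
   the chosen edge, since otherwise a neighbour closer to it would be larger.
   Once the solution is normalised there, the coordinate at the other end is a
   Lipschitz function of the remaining coordinates, by monotonicity, and these
   are functions of all coordinates with small Lipschitz constant. *)
Require Import Defs.
From HB Require Import structures.
From mathcomp Require Import all_boot all_order all_algebra finmap.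
From mathcomp Require Import all_classical all_reals all_analysis.
From mathcomp Require Import measurable_realfun perm ring lra.
Set Implicit Arguments.
Unset Strict Implicit.
Unset Printing Implicit Defensive.
Import Order.TTheory GRing.Theory Num.Theory.
Local Open Scope classical_set_scope.
Local Open Scope ring_scope.
(* mathcomp-classical has an unrelated [glue]. *)
Local Notation glue := Defs.glue.

(** * Activities with a unique system of weights *)

(** The order of the choices matters. The weights [w] are fixed first and [lam] is read off from the
    equation, so a solution exists by construction and only its uniqueness needs an argument. The
    bounds on the coordinates of a normalised solution involve only [r] and the number of nodes, so
    the decay rate [eta] can be chosen after all Lipschitz constants are known. On the tree the
    obstacle is that sites are generated from a root, so the chain is not visibly symmetric. Its
    laws are explicit products only over lists closed under parents, and all identities are reduced
    to such lists: with one event fixed, both sides of an identity are measures in the other event,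
    hence it is enough to compare them on cylinders. The chain itself is an image of Lebesgue
    measure on [[0, 1[], cut into nested intervals indexed by histories. Its invariance comes from
    the lemma that also serves uniqueness: the image under an automorphism is again simple with the
    same site and edge laws, and these determine a simple measure. *)

Section EdgeDistance.
Variables (n : nat) (h : rel 'I_n.+1) (e0 e1 : 'I_n.+1).

Fixpoint edge_ball (k : nat) : {set 'I_n.+1} :=
  if k is k'.+1 then
    edge_ball k' :|: [set i | [exists j, (j \in edge_ball k') && h i j]]
  else [set e0; e1].

Lemma edge_dist_exists : symmetric h -> (forall i j, connect h i j) ->
  exists d : 'I_n.+1 -> nat,
  [/\ forall i, (d i == 0)%N = (i == e0) || (i == e1),
      forall i j, h i j -> (d i <= (d j).+1)%N &
      forall i k, d i = k.+1 -> exists2 j, h i j & d j = k].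
Proof.
move=> hS hC.
have ballS k i j : j \in edge_ball k -> h i j -> i \in edge_ball k.+1.
  by move=> jk hij; rewrite /= !inE; apply/orP; right; apply/existsP; exists j;
    rewrite jk.
have bex i : exists k, i \in edge_ball k.
  have /connectP[p pp ->] := hC e0 i.
  elim/last_ind: p pp => [|p x IHp]; first by exists 0%N; rewrite /= !inE eqxx.
  rewrite rcons_path last_rcons => /andP[/IHp[k kP] hx].
  by exists k.+1; apply: ballS kP _; rewrite hS.
pose d i := ex_minn (bex i).
have dP i : i \in edge_ball (d i) by rewrite /d; case: ex_minnP.
have dmin i k : i \in edge_ball k -> (d i <= k)%N.
  by rewrite /d; case: ex_minnP => m _ hm /hm.
have dlip i j : h i j -> (d i <= (d j).+1)%N.
  by move=> hij; apply/dmin/(ballS _ _ j).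
exists d; split => // [i|i k dik].
  apply/idP/idP => [/eqP di0|/orP ie].
    by have := dP i; rewrite di0 /= !inE.
  by rewrite -leqn0 dmin //= !inE; apply/orP.
have := dP i; rewrite dik /= !inE => /orP[/dmin|/existsP[j /andP[/dmin jk hij]]].
  by rewrite dik ltnn.
exists j => //; apply/eqP; rewrite eqn_leq jk /=.
by have := dlip _ _ hij; rewrite dik.
Qed.

End EdgeDistance.

(** * The weight equation: bounds, contraction, choice of the activities *)

Section Weights.
Variables (R : realFieldType) (n : nat) (h : rel 'I_n.+1).
Implicit Types (w v lam : 'I_n.+1 -> R).

Definition nsum w i : R := \sum_(j | h i j) w j.

Lemma nsum_le w i c : (forall j, h i j -> w j <= c) -> 0 <= c ->
  nsum w i <= n.+1%:R * c.
Proof.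
move=> wc c0; apply: (le_trans (ler_sum _ wc)).
rewrite sumr_const -[X in X <= _]mulr_natl ler_wpM2r // ler_nat.
by rewrite (leq_trans (max_card _)) // card_ord.
Qed.

Lemma le_nsum w i j : (forall k, 0 <= w k) -> h i j -> w j <= nsum w i.
Proof.
move=> w0 hij; rewrite /nsum (bigD1 j) //= lerDl.
by apply: sumr_ge0 => k _; exact: w0.
Qed.

Lemma exprn_lip (a b X : R) k : 0 <= a <= X -> 0 <= b <= X ->
  `|a ^+ k - b ^+ k| <= k%:R * X ^+ k.-1 * `|a - b|.
Proof.
case/andP=> a0 aX /andP[b0 bX].
have X0 : 0 <= X by apply: le_trans aX.
rewrite subrXX normrM mulrC ler_wpM2r //.
apply: (le_trans (ler_norm_sum _ _ _)).
apply: (@le_trans _ _ (\sum_(i < k) X ^+ k.-1)).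
  apply: ler_sum => i _; rewrite normrM !normrX !ger0_norm //.
  have -> : X ^+ k.-1 = X ^+ (k.-1 - i) * X ^+ i.
    by rewrite -exprD subnK //; case: k i => [[]|k i] //=; rewrite -ltnS.
  by apply: ler_pM; rewrite ?exprn_ge0 // lerXn2r.
by rewrite sumr_const card_ord -[X in X <= _]mulr_natl.
Qed.

(* If the maximum were at a node off the edge, the heavier neighbour [p] would
   carry an even larger weight. *)
Lemma solution_le_max (r : nat) e0 e1 lam v kap :
  (forall b, b != e0 -> b != e1 ->
     exists2 p, h b p & n.+1%:R ^+ r * lam b < lam p) ->
  symmetric h -> 0 < kap -> (forall i, 0 < lam i) -> (forall i, 0 < v i) ->
  (forall i, v i = kap * lam i * nsum v i ^+ r) ->
  forall i, v i <= Num.max (v e0) (v e1).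
Proof.
move=> hp hS k0 l0 v0 vE i.
pose b := [arg max_(b > i) v b]%O.
have bmax j : v j <= v b.
  by rewrite /b; case: (@arg_maxP _ _ _ i xpredT v isT) => m _ /(_ j isT).
case: (eqVneq b e0) => [<-|be0]; first by rewrite le_max bmax.
case: (eqVneq b e1) => [<-|be1]; first by rewrite le_max bmax orbT.
have [p hbp lp] := hp b be0 be1.
suff : v b < v p by rewrite ltNge bmax.
(* Maximality bounds the sum at [b], while the sum at [p] contains the term [v b]; the ratio of the
   activities outweighs the factor [n.+1%:R ^+ r] lost between the two. *)
have bS : nsum v b <= n.+1%:R * v b by apply: nsum_le => //; exact: ltW.
have pS : v b <= nsum v p by apply: le_nsum => [k|]; [exact: ltW|rewrite hS].
have vb0 : 0 < v b ^+ r by apply: exprn_gt0.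
rewrite (vE b) (vE p) -!mulrA ltr_pM2l //.
apply: (@le_lt_trans _ _ (lam b * (n.+1%:R * v b) ^+ r)).
  rewrite ler_wpM2l ?(ltW (l0 _)) // lerXn2r ?nnegrE //.
    by apply: sumr_ge0 => j _; exact: ltW.
  by rewrite mulr_ge0 // (ltW (v0 _)).
apply: (@lt_le_trans _ _ (lam p * v b ^+ r)).
  by rewrite exprMn mulrA [lam b * _]mulrC ltr_pM2r.
rewrite ler_wpM2l ?(ltW (l0 _)) // lerXn2r ?nnegrE ?(ltW (v0 _)) //.
exact: le_trans (ltW (v0 _)) pS.
Qed.

Definition off_sum e0 e1 v i : R :=
  \sum_(j | h i j && ((j != e0) && (j != e1))) v j.

(** The two implications treat both choices of the edge at once: a loop, where [e0 = e1], or an edge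
    between nodes without loops. Either way the only neighbour of an end that lies on the edge is
    the other end. *)
Lemma nsum_edge e0 e1 v : symmetric h -> h e0 e1 ->
  (h e0 e0 -> e0 = e1) -> (h e1 e1 -> e0 = e1) ->
  nsum v e0 = v e1 + off_sum e0 e1 v e0 /\
  nsum v e1 = v e0 + off_sum e0 e1 v e1.
Proof.
move=> hS h01 h00 h11; split.
  rewrite /nsum (bigD1 e1) //=; congr (_ + _); apply: eq_bigl => j.
  case hj: (h e0 j) => //=; case: (eqVneq j e1) => [|je1]; first by rewrite andbF.
  rewrite andbT; apply/esym/eqP => je0; case/eqP: je1.
  by move: hj; rewrite je0 => /h00.
rewrite /nsum (bigD1 e0) /=; last by rewrite hS.
congr (_ + _); apply: eq_bigl => j.
case hj: (h e1 j) => //=; case: (eqVneq j e0) => [|je0] //=.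
apply/esym/eqP => je1; case/eqP: je0.
by move: hj; rewrite je1 => /h11.
Qed.

(* From [v e1 * (v e1 + s)^r = rho * (1 + s')^r], where [s] and [s'] are the
   contributions of the nodes off the edge. *)
Lemma edge_coord_lip (r : nat) (rho v1 s s' w1 t t' C E X : R) :
  0 < w1 -> w1 <= C -> 0 <= t -> 0 <= t' -> 0 < rho ->
  `|s - t| <= E -> `|s' - t'| <= E -> E <= X -> 0 <= s' -> w1 <= v1 ->
  v1 * (v1 + s) ^+ r = rho * (1 + s') ^+ r ->
  w1 * (w1 + t) ^+ r = rho * (1 + t') ^+ r ->
  v1 - w1 <= (1 + C * (r%:R * (1 + X) ^+ r.-1)) * E.
Proof.
move=> w0 wC t0 t'0 rho0 st st' EX s'0 w1v1.
have E0 : 0 <= E by apply: le_trans st.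
have X0 : 0 <= X by apply: le_trans EX.
have C0 : 0 < C by apply: lt_le_trans wC.
have wt0 : 0 < w1 + t by lra.
have v0 : 0 <= v1 by lra.
have X1 : 0 <= 1 + X by lra.
have E1 : 1 <= 1 + E by lra.
have E1X : 0 <= 1 + E <= 1 + X by apply/andP; split; lra.
have X11 : (0 : R) <= 1 <= 1 + X by rewrite ler01 lerDl.
have st2 : v1 - w1 <= E \/ w1 + t <= v1 + s.
  by case: (leP (v1 - w1) E) => dE; [left|right; move: st; rewrite ler_norml; lra].
have st2' : 1 + s' <= (1 + t') * (1 + E).
  by move: st' (mulr_ge0 t'0 E0); rewrite ler_norml; lra.
have s1 : 0 <= 1 + s' by lra.
have te : 0 <= (1 + t') * (1 + E) by rewrite mulr_ge0; lra.
have EE : 1 + E - 1 = E by lra.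
set c := r%:R * _; have c0 : 0 <= c by rewrite mulr_ge0 // exprn_ge0.
case: st2 => [dE _ _|st2 eqv eqw].
  apply: (le_trans dE); rewrite -[X in X <= _]mul1r ler_wpM2r // lerDl.
  by rewrite mulr_ge0 // ltW.
have vs0 : 0 <= v1 + s by apply: le_trans st2; exact: ltW.
(* Here [w1 + t <= v1 + s], so the left side is at most [rho * (1 + s') ^+ r]; by [st2'] this is at
   most [(1 + E) ^+ r] times the right side of the equation for [w1]. Cancelling gives
   [v1 <= w1 * (1 + E) ^+ r]. *)
have : v1 * (w1 + t) ^+ r <= w1 * (1 + E) ^+ r * (w1 + t) ^+ r.
  apply: (@le_trans _ _ (v1 * (v1 + s) ^+ r)).
    by rewrite ler_wpM2l // lerXn2r // nnegrE // ltW.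
  rewrite eqv [w1 * _]mulrC -mulrA eqw mulrCA ler_wpM2l ?(ltW rho0) //.
  by rewrite mulrC -exprMn lerXn2r.
rewrite ler_pM2r ?exprn_gt0 // => h1.
have := exprn_lip r E1X X11; rewrite expr1n EE (ger0_norm E0) -/c.
have E1' : 1 <= (1 + E) ^+ r by apply: exprn_ege1.
rewrite ger0_norm ?subr_ge0 //; move: h1 E1'; move: ((1 + E) ^+ r) => Er h1 E1' h2.
have : v1 - w1 <= C * (c * E).
  apply: (@le_trans _ _ (w1 * (Er - 1))); first by rewrite mulrBr mulr1 lerB.
  by apply: ler_pM; rewrite ?subr_ge0 // ltW.
rewrite mulrDl mul1r -mulrA => h3.
by apply: (le_trans h3); rewrite lerDr.
Qed.

Lemma ratio_lip (P Q P' Q' C B D : R) :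
  0 < C -> C^-1 <= Q -> C^-1 <= Q' -> 0 <= P' -> P' <= B -> Q' <= B ->
  `|P - P'| <= D -> `|Q - Q'| <= D ->
  `|P / Q - P' / Q'| <= C ^+ 2 * (B * (2 * D)).
Proof.
move=> C0 CQ CQ' P'0 P'B Q'B PP QQ.
have iC : 0 < C^-1 by rewrite invr_gt0.
have Q0 : 0 < Q by lra.
have Q'0 : 0 < Q' by lra.
have -> : P / Q - P' / Q' = Q^-1 * Q'^-1 * ((P - P') * Q' - P' * (Q - Q')).
  by field; rewrite !gt_eqF.
have iQ q : 0 < q -> C^-1 <= q -> q^-1 <= C.
  by move=> q0 Cq; rewrite -[C]invrK lef_pV2 ?posrE.
have D0 : 0 <= D by apply: le_trans PP.
rewrite normrM ger0_norm; last by rewrite mulr_ge0 // invr_ge0 ltW.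
apply: ler_pM => //; first by rewrite mulr_ge0 // invr_ge0 (ltW Q0, ltW Q'0).
  by rewrite expr2; apply: ler_pM; rewrite ?iQ // invr_ge0 ltW.
apply: (le_trans (ler_normB _ _)); rewrite !normrM (ger0_norm P'0) (gtr0_norm Q'0).
have -> : B * (2 * D) = D * B + B * D by ring.
by apply: lerD; apply: ler_pM => //; exact: ltW.
Qed.

Notation N := (n.+1%:R : R).

(** A solution divided by its value at [e0], with its equation divided by the one at [e0]: this
    eliminates [kap] and leaves only the ratios [rho i = lam i / lam e0]. *)
Definition normal_solution (r : nat) (e0 e1 : 'I_n.+1) (rho v : 'I_n.+1 -> R) :=
  [/\ v e0 = 1, forall i, 0 < v i, forall i, v i <= Num.max 1 (v e1) &
      forall i, v i = rho i * (nsum v i / nsum v e0) ^+ r].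

(** In the bound [N ^+ r * N ^+ r] one factor comes from [rho e1], the other from the quotient of
    the neighbour sums at [e1] and [e0]. If [v e1 <= 1], the first sum is at least [v e0 = 1] and
    the second at most [N]; otherwise [v e1] is the maximum, the first sum is at most [N * v e1] and
    the second at least [v e1]. *)
Lemma normal_solution_bounds r e0 e1 rho v : symmetric h -> h e0 e1 ->
  N ^- r <= rho e1 -> rho e1 <= N ^+ r ->
  normal_solution r e0 e1 rho v ->
  (N ^+ r * N ^+ r)^-1 <= v e1 /\ forall i, v i <= N ^+ r * N ^+ r.
Proof.
move=> hS h01 rho1 rho2 [v1 v0 vmax vE].
have N0 : 0 < N by rewrite ltr0n.
have N1 : 1 <= N by rewrite ler1n.
have Nr1 : 1 <= N ^+ r by apply: exprn_ege1.
have Nr0 : 0 < N ^+ r by apply: exprn_gt0.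
have vge0 i : 0 <= v i by apply: ltW.
have Av0 : v e1 <= nsum v e0 by apply: le_nsum.
have Av1 : 1 <= nsum v e1 by rewrite -v1; apply: le_nsum; rewrite // hS.
have Q0 : 0 < nsum v e0 by apply: lt_le_trans Av0.
have T0 : 0 <= nsum v e1 / nsum v e0.
  by rewrite divr_ge0 ?(ltW Q0) // (le_trans ler01).
case: (leP (v e1) 1) => v1le.
  have vle1 i : v i <= 1 by rewrite (le_trans (vmax i)) // ge_max lexx.
  split; last by move=> i; rewrite (le_trans (vle1 i)) // mulr_ege1.
  rewrite invfM (vE e1); apply: ler_pM; rewrite ?invr_ge0 ?(ltW Nr0) //.
  rewrite -exprVn lerXn2r ?nnegrE ?invr_ge0 ?(ltW N0) //.
  rewrite ler_pdivlMr // ler_pdivrMl //; apply: (@le_trans _ _ (N * 1)).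
    by apply: nsum_le => // j _; exact: vle1.
  by rewrite ler_wpM2l // ltW.
have vle i : v i <= v e1 by rewrite (le_trans (vmax i)) // ge_max lexx ltW.
suff vC : v e1 <= N ^+ r * N ^+ r.
  split; last by move=> i; apply: le_trans vC.
  by rewrite (le_trans _ (ltW v1le)) // invf_le1 ?mulr_ege1 // mulr_gt0.
rewrite (vE e1); apply: ler_pM => //.
- by rewrite (le_trans _ rho1) // invr_ge0 ltW.
- exact: exprn_ge0.
- rewrite lerXn2r ?nnegrE ?(ltW N0) // ler_pdivrMr //.
  apply: (@le_trans _ _ (N * v e1)); first by apply: nsum_le.
  by rewrite ler_wpM2l // ltW.
Qed.

Lemma nsum_dist v w i : symmetric h ->
  `|nsum v i - nsum w i| <= \sum_j `|v j - w j|.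
Proof.
move=> hS; rewrite -sumrB; apply: (le_trans (ler_norm_sum _ _ _)).
by rewrite [X in _ <= X](bigID (h i)) /= lerDl sumr_ge0.
Qed.

(* A bound for the Lipschitz constant of [(nsum v i / nsum v e0) ^+ r] in the
   off-edge coordinates of a normal solution [v]; all coordinates are at most
   [C]. *)
Definition contr_const (r : nat) : R :=
  let C := N ^+ r * N ^+ r in
  r%:R * (C * (N * C)) ^+ r.-1 *
    (C ^+ 2 * (N * C * (2 * (1 + (1 + C * (r%:R * (1 + N * (C + C)) ^+ r.-1)))))).

(** Let [E] be the l1-distance of the two solutions off the edge. The coordinate at [e1] adds at
    most [K * E], so every off-edge coordinate differs by at most [eps * L * E]; summing gives
    [E <= N * (eps * L) * E] with a factor below 1, which forces [E = 0]. *)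
Lemma normal_solution_unique r e0 e1 rho v w eps :
  symmetric h -> h e0 e1 -> (h e0 e0 -> e0 = e1) -> (h e1 e1 -> e0 = e1) ->
  (forall i, 0 < rho i) -> N ^- r <= rho e1 -> rho e1 <= N ^+ r ->
  (forall b, b != e0 -> b != e1 -> rho b <= eps) -> 0 <= eps ->
  N * (eps * contr_const r) < 1 ->
  normal_solution r e0 e1 rho v -> normal_solution r e0 e1 rho w ->
  forall i, v i = w i.
Proof.
move=> hS h01 h00 h11 rho0 rho1 rho2 rhoeps eps0 small.
(* [edge_coord_lip] bounds the difference at [e1] on one side only. *)
wlog vw : v w / w e1 <= v e1.
  move=> H Sv Sw i; case: (leP (w e1) (v e1)) => vw; first exact: H.
  by apply/esym/H => //; apply: ltW.
move=> Sv Sw.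
have [v1C vC] := normal_solution_bounds hS h01 rho1 rho2 Sv.
have [w1C wC] := normal_solution_bounds hS h01 rho1 rho2 Sw.
move: Sv Sw => [v1 v0 _ vE] [w1 w0 _ wE].
have N0 : 0 < N by rewrite ltr0n.
move: small; rewrite /contr_const.
set C := N ^+ r * N ^+ r in v1C vC w1C wC *; set K := 1 + C * _.
have [D DE] : exists D, D = 1 + K by exists (1 + K).
rewrite -DE => small.
have C0 : 0 < C by rewrite mulr_gt0 // exprn_gt0.
clearbody C; have Cge0 := ltW C0; have Nge0 := ltW N0.
have NC0 : 0 <= N * C by apply: mulr_ge0.
have CNC0 : 0 <= C * (N * C) by apply: mulr_ge0.
have D0 : 0 <= D.
  rewrite DE /K !addr_ge0 // mulr_ge0 // mulr_ge0 // exprn_ge0 // addr_ge0 //.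
  by rewrite mulr_ge0 // addr_ge0.
have v0' i : 0 <= v i by apply: ltW.
have w0' i : 0 <= w i by apply: ltW.
pose off := fun j => (j != e0) && (j != e1).
pose E := \sum_(j | off j) `|v j - w j|.
have E0 : 0 <= E by apply: sumr_ge0.
have dle j : `|v j - w j| <= C + C.
  by rewrite (le_trans (ler_normB _ _)) // !ger0_norm // lerD.
have EX : E <= N * (C + C).
  apply: (le_trans (ler_sum _ (fun j _ => dle j))).
  rewrite sumr_const -[X in X <= _]mulr_natl ler_wpM2r ?ler_nat ?addr_ge0 ?ltW //.
  by rewrite (leq_trans (max_card _)) // card_ord.
have offE i : `|off_sum e0 e1 v i - off_sum e0 e1 w i| <= E.
  rewrite -sumrB; apply: (le_trans (ler_norm_sum _ _ _)).
  rewrite /E [X in _ <= X](bigID (h i)) /=.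
  rewrite [X in _ <= X + _](eq_bigl (fun j => h i j && off j)) => [|j].
    by rewrite lerDl sumr_ge0.
  by rewrite andbC.
have off0 u i : (forall j, 0 <= u j) -> 0 <= off_sum e0 e1 u i.
  by move=> u0; apply: sumr_ge0.
have [nv0 nv1] := nsum_edge v hS h01 h00 h11.
have [nw0 nw1] := nsum_edge w hS h01 h00 h11.
have edge_eq u : u e0 = 1 -> (forall i, 0 < u i) ->
    (forall i, u i = rho i * (nsum u i / nsum u e0) ^+ r) ->
    nsum u e0 = u e1 + off_sum e0 e1 u e0 ->
    nsum u e1 = u e0 + off_sum e0 e1 u e1 ->
    u e1 * (u e1 + off_sum e0 e1 u e0) ^+ r =
    rho e1 * (1 + off_sum e0 e1 u e1) ^+ r.
  move=> u1 u0 uE n0 n1; rewrite [X in X * _](uE e1) n0 n1 u1 expr_div_n.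
  rewrite -mulrA divfK // expf_neq0 // gt_eqF // ltr_pwDl // off0 // => j.
  exact: ltW.
have dE : v e1 - w e1 <= K * E.
  apply: (edge_coord_lip (w0 e1) (wC e1) _ _ (rho0 e1) (offE e0) (offE e1) EX
    _ vw (edge_eq _ v1 v0 vE nv0 nv1) (edge_eq _ w1 w0 wE nw0 nw1)); exact: off0.
(* Both solutions are 1 at [e0], so on the edge only [e1] can contribute. *)
have totE : \sum_j `|v j - w j| <= D * E.
  rewrite (bigID off) /= -/E DE mulrDl mul1r lerD2l.
  apply: le_trans dE; rewrite (bigID (pred1 e1)) /= (big_pred1 e1) => [|j].
    rewrite big1 ?addr0 ?ger0_norm ?subr_ge0 // => j.
    rewrite negb_and !negbK; case: eqVneq => [->|_] /=; last by case: eqVneq.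
    by rewrite v1 w1 subrr normr0.
  by rewrite /off /=; case: (j == e1); rewrite andbF.
have nC u i : (forall j, u j <= C) -> nsum u i <= N * C.
  by move=> uC; apply: nsum_le => //; exact: ltW.
have lowv : C^-1 <= nsum v e0 by apply: (le_trans v1C); apply: le_nsum.
have loww : C^-1 <= nsum w e0 by apply: (le_trans w1C); apply: le_nsum.
have iC0 : 0 < C^-1 by rewrite invr_gt0.
have nge0 u i : (forall j, 0 <= u j) -> 0 <= nsum u i.
  by move=> u0; apply: sumr_ge0.
have Tb u i : (forall j, 0 <= u j) -> (forall j, u j <= C) -> C^-1 <= nsum u e0 ->
    0 <= nsum u i / nsum u e0 <= C * (N * C).
  move=> u0 uC lowu; have Q0 := lt_le_trans iC0 lowu.
  rewrite divr_ge0 ?nge0 //= [_ / _]mulrC; apply: ler_pM; rewrite ?nge0 ?nC //.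
    by rewrite invr_ge0 ltW.
  by rewrite -[C]invrK lef_pV2 ?posrE.
set L := r%:R * _ * _ in small.
have offL b : off b -> `|v b - w b| <= eps * L * E.
  move=> /andP[b0 b1].
  have -> : eps * L * E = eps * (r%:R * (C * (N * C)) ^+ r.-1 *
      (C ^+ 2 * (N * C * (2 * (D * E))))) by rewrite /L; ring.
  rewrite (vE b) (wE b) -mulrBr normrM (gtr0_norm (rho0 b)).
  apply: ler_pM => //; [exact: ltW|exact: rhoeps|].
  apply: (le_trans (exprn_lip r (Tb _ b v0' vC lowv) (Tb _ b w0' wC loww))).
  apply: ler_wpM2l; first by apply: mulr_ge0 => //; apply: exprn_ge0.
  apply: ratio_lip => //; rewrite ?nge0 ?nC //;
    exact: (le_trans (nsum_dist _ _ _ hS)).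
have EE : E <= N * (eps * L) * E.
  apply: (le_trans (ler_sum _ (fun j Oj => offL j Oj))).
  rewrite sumr_const -[X in X <= _]mulr_natl mulrA ler_wpM2r // ler_wpM2r //.
    rewrite mulr_ge0 // /L mulr_ge0 //; first by rewrite mulr_ge0 // exprn_ge0.
    by rewrite mulr_ge0 ?exprn_ge0 // mulr_ge0 // mulr_ge0.
  by rewrite ler_nat (leq_trans (max_card _)) // card_ord.
have {}E0 : E = 0.
  apply/eqP; rewrite eq_le E0 andbT leNgt; apply/negP => Epos.
  by move: EE; rewrite -[X in X <= _]mul1r ler_pM2r // leNgt small.
move: totE; rewrite E0 mulr0 => tot0 i.
apply/eqP; rewrite -subr_eq0 -normr_le0 (le_trans _ tot0) //.
by rewrite (bigD1 i) //= lerDl sumr_ge0.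
Qed.

Lemma contr_const_ge0 r : 0 <= contr_const r.
Proof.
rewrite /contr_const; set C := N ^+ r * N ^+ r.
have C0 : 0 <= C by rewrite mulr_ge0 // exprn_ge0.
move: C C0 => C C0.
have NC0 : 0 <= N * C by apply: mulr_ge0.
rewrite mulr_ge0 //; first by rewrite mulr_ge0 // exprn_ge0 // mulr_ge0.
rewrite mulr_ge0 ?exprn_ge0 // mulr_ge0 // mulr_ge0 // !addr_ge0 // mulr_ge0 //.
by rewrite mulr_ge0 // exprn_ge0 // addr_ge0 // mulr_ge0 // addr_ge0.
Qed.

Lemma solution_normal r e0 e1 lam v kap :
  0 < kap -> (forall i, 0 < lam i) -> (forall i, 0 < v i) ->
  (forall i, v i <= Num.max (v e0) (v e1)) -> h e0 e1 ->
  (forall i, v i = kap * lam i * nsum v i ^+ r) ->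
  normal_solution r e0 e1 (fun i => lam i / lam e0) (fun i => v i / v e0).
Proof.
move=> k0 l0 v0 vmax h01 vE; have nE i : nsum (fun i => v i / v e0) i = nsum v i / v e0.
  by rewrite /nsum mulr_suml.
have n0 : 0 < nsum v e0.
  by apply: (lt_le_trans (v0 e1)); apply: le_nsum => // k; exact: ltW.
split=> [|i|i|i]; rewrite ?divff ?gt_eqF // ?divr_gt0 //.
  have -> : 1 = v e0 / v e0 by rewrite divff ?gt_eqF.
  have iv : 0 <= (v e0)^-1 by rewrite invr_ge0 ltW.
  by rewrite -maxr_pMl // ler_wpM2r.
rewrite !nE invf_div mulrA divfK ?gt_eqF // [in LHS](vE i) [in LHS](vE e0).
rewrite expr_div_n; field.
by rewrite !gt_eqF // exprn_gt0.
Qed.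

(** With activity about [eta ^+ k] at distance [k], the neighbour sum at distance [k.+1] is
    dominated by the neighbours at distance [k], and the weight equation becomes this recursion. *)
Fixpoint scale (r : nat) (eta : R) (k : nat) : R :=
  if k is k'.+1 then eta ^+ k * scale r eta k' ^+ r else 1.

(* [w i = scale r eta (d i)], with [d] the distance to a fixed edge (a loop if
   there is one); then [lam i] is [eta ^+ d i] up to a factor [N ^+ r]. *)
Lemma unique_weights (r : nat) : (1 <= r)%N -> symmetric h ->
  (forall i j, connect h i j) -> (exists i j, h i j) ->
  exists lam w, [/\ forall i, 0 < lam i, forall i, 0 < w i,
    forall i, w i = lam i * nsum w i ^+ r &
    forall v kap, 0 < kap -> (forall i, 0 < v i) ->
      (forall i, v i = kap * lam i * nsum v i ^+ r) ->
      exists2 c, 0 < c & forall i, v i = c * w i].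
Proof.
move=> r1 hS hC hE.
have [e0 [e1 [h01 h00 h11]]] : exists e0 e1,
    [/\ h e0 e1, h e0 e0 -> e0 = e1 & h e1 e1 -> e0 = e1].
  case: (boolP [exists i, h i i]) => [/existsP[i hii]|/existsPn noloop].
    by exists i, i.
  case: hE => i [j hij]; exists i, j; split=> // hh.
    by have := noloop i; rewrite hh.
  by have := noloop j; rewrite hh.
have [d [d0 dlip dpred]] := edge_dist_exists e0 e1 hS hC.
have de0 : d e0 = 0%N by apply/eqP; rewrite d0 eqxx.
have de1 : d e1 = 0%N by apply/eqP; rewrite d0 eqxx orbT.
have N0 : 0 < N by rewrite ltr0n.
have N1 : 1 <= N by rewrite ler1n.
have Nr1 : 1 <= N ^+ r by apply: exprn_ege1.
have Nr0 : 0 < N ^+ r by apply: exprn_gt0.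
have NNr0 : 0 <= N ^+ r * N ^+ r by rewrite mulr_ge0 // ltW.
have L0 : 0 <= N * (N ^+ r * contr_const r).
  apply: mulr_ge0 => //; apply: mulr_ge0; first exact: ltW.
  exact: contr_const_ge0.
(* One summand for each demand on [eta = A^-1]: at most 1, below [(N ^+ r * N ^+ r)^-1] so that
   moving closer to the edge gains enough activity, and small enough for the contraction. *)
pose A := 1 + N ^+ r * N ^+ r + N * (N ^+ r * contr_const r).
have A0 : 0 < A by rewrite /A -addrA ltr_pwDl // addr_ge0.
pose eta := A^-1.
have eta0 : 0 < eta by rewrite invr_gt0.
have eta1 : eta <= 1 by rewrite invf_le1 // /A -addrA lerDl addr_ge0.
have etaN : eta * (N ^+ r * N ^+ r) < 1.
  by rewrite ltr_pdivrMl // mulr1 /A addrAC ltrDr ltr_pwDl.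
have etaL : N * (eta * N ^+ r * contr_const r) < 1.
  have -> : N * (eta * N ^+ r * contr_const r) =
            eta * (N * (N ^+ r * contr_const r)) by ring.
  by rewrite ltr_pdivrMl // mulr1 /A ltrDr ltr_pwDl.
pose W := scale r eta.
have W0 k : 0 < W k.
  by elim: k => //= k IHk; rewrite mulr_gt0 // exprn_gt0.
have W1 k : W k <= 1.
  elim: k => //= k IHk; rewrite mulr_ile1 ?exprn_ge0 ?exprn_ile1 ?(ltW eta0) //.
    by rewrite -/W ltW.
  by rewrite -/W ltW.
have WS k : W k.+1 <= W k.
  rewrite [X in X <= _](_ : _ = eta ^+ k.+1 * W k ^+ r) //.
  apply: (@le_trans _ _ (1 * W k)); last by rewrite mul1r.
  apply: ler_pM; rewrite ?exprn_ge0 ?(ltW eta0) ?(ltW (W0 k)) //.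
    by rewrite exprn_ile1 // ltW.
  by rewrite -[X in _ <= X]expr1; apply: ler_wiXn2l => //; exact: ltW.
have Wanti a b : (a <= b)%N -> W b <= W a.
  move=> ab; rewrite -(subnK ab); elim: (b - a)%N => //= m IHm.
  exact: le_trans (WS _) IHm.
(* [lam] is defined so that [w] solves the equation with [kap = 1]. *)
pose w i := W (d i); pose lam i := w i / nsum w i ^+ r.
have w0 i : 0 < w i by apply: W0.
have wrec i : w i = eta ^+ d i * W (d i).-1 ^+ r.
  by rewrite /w; case: (d i) => [|k] //=; rewrite expr1n mulr1.
(* A node off the edge has a neighbour one step closer. At distance 0 the predecessor is again 0,
   and the other end of the edge has weight [W 0]. *)
have nlow i : W (d i).-1 <= nsum w i.
  have w0' k : 0 <= w k by apply: ltW.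
  case di: (d i) => [|k] /=.
    move/eqP: di; rewrite d0 => /orP[] /eqP ->.
      have -> : W 0 = w e1 by rewrite /w de1.
      exact: le_nsum.
    have -> : W 0 = w e0 by rewrite /w de0.
    by apply: le_nsum => //; rewrite hS.
  by have [j hij <-] := dpred i k di; apply: le_nsum.
have nup i : nsum w i <= N * W (d i).-1.
  apply: nsum_le => [j hij|]; last exact: ltW.
  apply: Wanti; have := dlip _ _ hij; by case: (d i).
have n0 i : 0 < nsum w i by apply: lt_le_trans (nlow i).
have nr0 i : 0 < nsum w i ^+ r by apply: exprn_gt0.
have lup i : lam i <= eta ^+ d i.
  rewrite ler_pdivrMr // wrec ler_wpM2l ?exprn_ge0 ?(ltW eta0) //.
  by rewrite lerXn2r ?nnegrE ?(ltW (W0 _)) ?(ltW (n0 _)).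
have llow i : eta ^+ d i / N ^+ r <= lam i.
  rewrite ler_pdivlMr // wrec -mulrA ler_wpM2l ?exprn_ge0 ?(ltW eta0) //.
  rewrite ler_pdivrMl // -exprMn lerXn2r ?nnegrE ?(ltW (n0 _)) //.
  by rewrite mulr_ge0 ?(ltW N0) ?(ltW (W0 _)).
have l0 i : 0 < lam i by rewrite divr_gt0.
have wE i : w i = lam i * nsum w i ^+ r by rewrite divfK // gt_eqF.
have heavier b : b != e0 -> b != e1 -> exists2 p, h b p & N ^+ r * lam b < lam p.
  move=> b0 b1; case db: (d b) => [|k].
    by move/eqP: db; rewrite d0 (negbTE b0) (negbTE b1).
  have [p hbp dp] := dpred b k db; exists p => //.
  apply: lt_le_trans (llow p); rewrite dp ltr_pdivlMr // mulrAC.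
  apply: (@le_lt_trans _ _ (N ^+ r * N ^+ r * eta ^+ k.+1)).
    by rewrite ler_wpM2l // -db.
  by rewrite exprS mulrA [_ * eta]mulrC -[X in _ < X]mul1r ltr_pM2r ?exprn_gt0.
have rho0 i : 0 < lam i / lam e0 by rewrite divr_gt0.
have l0up : lam e0 <= 1 by have := lup e0; rewrite de0.
have l0low : (N ^+ r)^-1 <= lam e0 by have := llow e0; rewrite de0 mul1r.
have rho1 : N ^- r <= lam e1 / lam e0.
  have := llow e1; rewrite de1 mul1r => /le_trans; apply.
  by rewrite ler_pdivlMr // ler_piMr // ltW.
have bound x : 0 <= x -> x / lam e0 <= x * N ^+ r.
  by move=> x0; rewrite ler_wpM2l // -[N ^+ r]invrK lef_pV2 ?posrE ?invr_gt0.
have rho2 : lam e1 / lam e0 <= N ^+ r.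
  apply: (le_trans (bound _ (ltW (l0 e1)))); rewrite ler_piMl ?(ltW Nr0) //.
  by have := lup e1; rewrite de1.
have rhoeps b : b != e0 -> b != e1 -> lam b / lam e0 <= eta * N ^+ r.
  move=> b0 b1; apply: (le_trans (bound _ (ltW (l0 b)))); rewrite ler_pM2r //.
  apply: (le_trans (lup b)); case db: (d b) => [|k].
    by move/eqP: db; rewrite d0 (negbTE b0) (negbTE b1).
  by rewrite -[X in _ <= X]expr1; apply: ler_wiXn2l => //; exact: ltW.
have eps0 : 0 <= eta * N ^+ r by rewrite mulr_ge0 // ltW.
have normal u kap : 0 < kap -> (forall i, 0 < u i) ->
    (forall i, u i = kap * lam i * nsum u i ^+ r) ->
    normal_solution r e0 e1 (fun i => lam i / lam e0) (fun i => u i / u e0).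
  move=> k0 u0 uE; apply: (solution_normal k0) => //.
  exact: (solution_le_max heavier hS k0).
exists lam, w; split=> // v kap k0 v0 vE; exists (v e0) => // i.
have wE1 j : w j = 1 * lam j * nsum w j ^+ r by rewrite mul1r.
have := normal_solution_unique hS h01 h00 h11 rho0 rho1 rho2 rhoeps eps0 etaL
  (normal v kap k0 v0 vE) (normal w 1 ltr01 w0 wE1) i.
have -> : w e0 = 1 by rewrite /w de0.
by rewrite divr1 => <-; rewrite mulrC divfK // gt_eqF.
Qed.

End Weights.

(** * The regular tree *)

Section Tree.
Variable r : nat.
Implicit Types (u v x y : site r) (a b : 'I_r.+1) (s : seq (site r)).

Definition root : site r := Sub [::] isT.
Definition pa v : site r := insubd root (take (size (val v)).-1 (val v)).
(** The default [root] is taken when the longer word is not reduced; hence the guard [extendable].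
    Likewise [pa] fixes the root. *)
Definition ext u a : site r := insubd root (rcons (val u) a).
Definition extendable u a : bool := reducedw (rcons (val u) a).
(** Right multiplication by the generator [a] in the free product: the one letter that cannot be
    appended cancels the last letter. So letters label the edges at each site. *)
Definition nbr u a : site r := if extendable u a then ext u a else pa u.

Lemma reducedw_rcons (w : seq 'I_r.+1) a :
  reducedw (rcons w a) = reducedw w && ((w == [::]) || (last ord0 w != a)).
Proof.
by case: w => [|x w] //=; rewrite /reducedw /= rcons_path.
Qed.

Lemma val_pa v : val (pa v) = take (size (val v)).-1 (val v).
Proof.
rewrite val_insubd; case: ifP => // /negbT /negP[].
exact: take_sorted (valP v).
Qed.

Lemma val_ext u a : extendable u a -> val (ext u a) = rcons (val u) a.
Proof. by move=> e; rewrite val_insubd; rewrite /extendable in e; rewrite e. Qed.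

Lemma site_rcons v : v != root ->
  val v = rcons (val (pa v)) (last ord0 (val v)).
Proof.
rewrite -val_eqE /= val_pa; case: v => w /= _.
case/lastP: w => [//|w a] _.
by rewrite size_rcons last_rcons /= -[in take _ _]cats1 take_size_cat.
Qed.

Lemma size_site v : v != root -> size (val v) = (size (val (pa v))).+1.
Proof. by move/site_rcons => {1}->; rewrite size_rcons. Qed.

Lemma ext_neq_root u a : extendable u a -> ext u a != root.
Proof. by move=> e; rewrite -val_eqE /= val_ext //; case: (val u). Qed.

Lemma pa_ext u a : extendable u a -> pa (ext u a) = u.
Proof.
move=> e; apply: val_inj; rewrite val_pa val_ext // size_rcons /=.
by rewrite -cats1 take_size_cat.
Qed.

Lemma extendable_pa v : v != root -> extendable (pa v) (last ord0 (val v)).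
Proof. by move=> v0; rewrite /extendable -site_rcons //; exact: valP. Qed.

Lemma ext_pa v : v != root -> ext (pa v) (last ord0 (val v)) = v.
Proof.
by move=> v0; apply: val_inj; rewrite val_ext ?extendable_pa // -site_rcons.
Qed.

Lemma childE u v : child u v = (v != root) && (u == pa v).
Proof.
rewrite /child; apply/andP/andP => [[/eqP sv /eqP uv]|[v0 /eqP->]].
  split; first by apply: contraTneq isT => v0; move: sv; rewrite v0.
  by rewrite -val_eqE /= val_pa sv /= -uv.
split; first by rewrite size_site.
by rewrite [in X in _ == X](site_rcons v0) -cats1 take_size_cat.
Qed.

Lemma tadjE u v : tadj u v = ((v != root) && (u == pa v)) || ((u != root) && (v == pa u)).
Proof. by rewrite /tadj !childE. Qed.

Lemma tadjC u v : tadj u v = tadj v u.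
Proof. by rewrite /tadj orbC. Qed.

Lemma tadj_pa v : v != root -> tadj (pa v) v.
Proof. by move=> v0; rewrite tadjE v0 eqxx. Qed.

Lemma tadjP u v : reflect (exists a, v = nbr u a) (tadj u v).
Proof.
rewrite tadjE; apply: (iffP orP).
  case=> /andP[x0 /eqP xE].
    by exists (last ord0 (val v)); rewrite /nbr xE extendable_pa // ext_pa.
  exists (last ord0 (val u)); rewrite /nbr xE; case: ifP => //.
  rewrite /extendable reducedw_rcons => /andP[_ /orP[/eqP u0|]]; last by rewrite eqxx.
  by case/eqP: x0; apply: val_inj.
case=> a ->; rewrite /nbr; case: ifP => e.
  by left; rewrite ext_neq_root // pa_ext // eqxx.
right; rewrite eqxx andbT; apply: contraFneq e => ->.
by rewrite /extendable.
Qed.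

Lemma tadj_irr u v : tadj u v -> u != v.
Proof.
by rewrite tadjE => /orP[] /andP[x0 /eqP xE]; rewrite -val_eqE;
  apply/eqP => /(congr1 size); rewrite (size_site x0) xE => /esym/eqP;
  rewrite ?(eqn_leq, ltnn, andbF).
Qed.

Definition prefix_of u y := take (size (val u)) (val y) == val u.

(* The label of the first edge on the way from [u] to [y]. *)
Definition dir u y : 'I_r.+1 :=
  if prefix_of u y then nth ord0 (val y) (size (val u)) else last ord0 (val u).

Lemma prefix_of_refl u : prefix_of u u.
Proof. by rewrite /prefix_of take_size. Qed.

Lemma prefix_of_size u y : prefix_of u y -> y != u -> (size (val u) < size (val y))%N.
Proof.
move=> /eqP uy yu; rewrite ltnNge; apply: contra yu => yu.
by rewrite -val_eqE -uy take_oversize.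
Qed.

(** The subtree below [u] is joined to the rest only by the edge from [u] to its parent. *)
Lemma prefix_of_child u x y : y != root -> x = pa y -> y != u ->
  prefix_of u y = prefix_of u x.
Proof.
move=> y0 -> yu; rewrite /prefix_of.
have yE := site_rcons y0; set p := val (pa y) in yE *.
case: (leqP (size (val u)) (size p)) => [up|pu].
  by rewrite yE -cats1 takel_cat.
rewrite !take_oversize ?(ltnW pu) //; last by rewrite yE size_rcons.
rewrite -val_eqE in yu; rewrite (negbTE yu); apply/esym/eqP => pE.
by rewrite pE ltnn in pu.
Qed.

(** Hence [dir u] is constant on each component of the tree without [u], which is how different
    branches are told apart. *)
Lemma dir_tadj u x y : tadj x y -> x != u -> y != u -> dir u x = dir u y.
Proof.
wlog : x y / y != root /\ x = pa y.
  move=> H xy; move: (xy); rewrite tadjE => /orP[] /andP[z0 /eqP zE] xu yu.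
    exact: H.
  by apply/esym/H; rewrite // tadjC.
move=> [y0 xE] _ xu yu; rewrite /dir (prefix_of_child y0 xE yu).
case: ifP => // /prefix_of_size /(_ xu) sux.
by rewrite [in RHS]site_rcons // -xE nth_rcons sux.
Qed.

Lemma dir_nbr u a : dir u (nbr u a) = a.
Proof.
rewrite /nbr /dir; case: (boolP (extendable u a)) => e.
  by rewrite /prefix_of val_ext // -cats1 take_size_cat // eqxx nth_cat ltnn subnn.
have u0 : u != root by apply: contraNneq e => ->.
rewrite /prefix_of val_pa take_oversize; last by rewrite size_take; case: ltnP => // /ltnW.
case: eqP => [/(congr1 size)|_].
  rewrite -val_pa (size_site u0) => /eqP; by rewrite eqn_leq ltnn andbF.
move: e; rewrite /extendable reducedw_rcons (valP u) /=.
by rewrite negb_or negbK => /andP[_ /eqP].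
Qed.

Lemma nbr_neq u a : nbr u a != u.
Proof. by rewrite eq_sym; apply: tadj_irr; apply/tadjP; exists a. Qed.

Lemma avoid_conn_refl u x : x != u -> avoid_conn u x x.
Proof. by move=> xu; exists [::]; rewrite /= xu. Qed.

Lemma avoid_conn_trans u x y z :
  avoid_conn u x y -> avoid_conn u y z -> avoid_conn u x z.
Proof.
move=> [p [pp pl pu]] [q [qp ql qu]]; exists (p ++ q); split.
- by rewrite cat_path pp pl.
- by rewrite last_cat pl.
- by move: pu qu => /=; rewrite all_cat => /andP[-> ->] /andP[].
Qed.

Lemma avoid_conn_tadj u x y : x != u -> y != u -> tadj x y -> avoid_conn u x y.
Proof. by move=> xu yu xy; exists [:: y]; rewrite /= xy xu yu. Qed.

Lemma avoid_conn_neq u x y : avoid_conn u x y -> x != u /\ y != u.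
Proof.
move=> [p [_ <- /allP pu]]; split; first by apply: pu; rewrite mem_head.
exact/pu/mem_last.
Qed.

Lemma avoid_conn_ind u (P : site r -> Prop) x :
  P x -> (forall y z, y != u -> z != u -> tadj y z -> P y -> P z) ->
  forall y, avoid_conn u x y -> P y.
Proof.
move=> Px PS y [p [pp <- pu]] {y}; elim: p x Px pp pu => //= y p IHp x Px.
case/andP=> xy pp /and3P[xu yu pu]; apply: IHp => //=; last by rewrite yu.
exact: PS xy Px.
Qed.

Lemma avoid_conn_sym u x y : avoid_conn u x y -> avoid_conn u y x.
Proof.
move=> xy; have [xu _] := avoid_conn_neq xy; move: y xy.
apply: (@avoid_conn_ind u (fun y => avoid_conn u y x)) => [|y z yu zu yz].
  exact: avoid_conn_refl.
by apply: avoid_conn_trans; apply: avoid_conn_tadj; rewrite // tadjC.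
Qed.

Definition branch u a : set (site r) := [set y | avoid_conn u (nbr u a) y].

Lemma branch_component u a : component u (branch u a).
Proof. by exists (nbr u a); split => //; exact: nbr_neq. Qed.

Lemma branch_dir u a y : branch u a y -> y != u /\ dir u y = a.
Proof.
apply: (@avoid_conn_ind u (fun y => y != u /\ dir u y = a)) =>
  [|y' z yu zu yz [_ <-]]; first by rewrite nbr_neq dir_nbr.
by split=> //; apply/esym/dir_tadj.
Qed.

Lemma site_ind (P : site r -> Prop) :
  P root -> (forall v, v != root -> P (pa v) -> P v) -> forall v, P v.
Proof.
move=> P0 PS v; move: {2}(size (val v)) (leqnn (size (val v))) => m.
elim: m v => [|m IHm] v.
  rewrite leqn0 size_eq0 => /eqP v0; suff -> : v = root by [].
  exact: val_inj.
case: (eqVneq v root) => [->//|v0]; rewrite size_site // ltnS => /IHm.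
exact: PS.
Qed.

(** A site below [u] climbs until it meets a child of [u]. Any other site reaches [pa u] through the
    root, and both halves of that path avoid the subtree below [u]. *)
Lemma dir_branch u y : y != u -> branch u (dir u y) y.
Proof.
have up z : ~~ prefix_of u z -> avoid_conn u root z.
  elim/site_ind: z => [u0|z z0 IHz uz].
    by apply: avoid_conn_refl; apply: contraNneq u0 => <-; exact: prefix_of_refl.
  have zu : z != u by apply: contraNneq uz => ->; exact: prefix_of_refl.
  have upz : ~~ prefix_of u (pa z) by rewrite -(prefix_of_child z0 erefl zu).
  apply: (avoid_conn_trans (IHz upz)); apply: avoid_conn_tadj => //.
    by apply: contraNneq upz => ->; exact: prefix_of_refl.
  exact: tadj_pa.
rewrite /branch /= /dir; case: ifP => [uy yu|/negbT uy yu].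
  elim/site_ind: y uy yu => [|y y0 IHy uy yu].
    rewrite /prefix_of /= => /eqP u0; case/eqP; exact: val_inj.
  case: (eqVneq (pa y) u) => [pyu|pyu].
    rewrite [in nth _ _](site_rcons y0) pyu nth_rcons ltnn eqxx.
    have -> : nbr u (last ord0 (val y)) = y.
      by rewrite /nbr -pyu extendable_pa // ext_pa.
    exact: avoid_conn_refl.
  have upy : prefix_of u (pa y) by rewrite -(prefix_of_child y0 erefl yu).
  rewrite [in nth _ _](site_rcons y0) nth_rcons prefix_of_size //.
  by apply: (avoid_conn_trans (IHy upy pyu)); apply: avoid_conn_tadj => //; exact: tadj_pa.
have u0 : u != root by apply: contraNneq uy => ->; rewrite /prefix_of take0.
have -> : nbr u (last ord0 (val u)) = pa u.
  rewrite /nbr /extendable reducedw_rcons eqxx orbF.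
  case: ifP => // /andP[_ /eqP ue]; case/eqP: u0; exact: val_inj.
apply: (avoid_conn_trans (avoid_conn_sym (up (pa u) _))) (up _ uy).
rewrite /prefix_of; apply/eqP => /(congr1 size); rewrite size_take (size_site u0).
by case: ltnP => [/ltnW|_ /eqP]; rewrite ?ltnn // eqn_leq ltnn andbF.
Qed.

Lemma branch_inj u : injective (branch u).
Proof.
move=> a b ab; have : branch u a (nbr u a) by apply: avoid_conn_refl; exact: nbr_neq.
by rewrite ab => /branch_dir[_]; rewrite dir_nbr.
Qed.

Lemma component_tadj u C x y : component u C -> C x -> tadj x y -> y != u -> C y.
Proof.
move=> [z [_ ->]] zx xy yu; have [_ xu] := avoid_conn_neq zx.
exact: avoid_conn_trans zx (avoid_conn_tadj xu yu xy).
Qed.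

Lemma component_neq u C x : component u C -> C x -> x != u.
Proof. by move=> [z [_ ->]] /avoid_conn_neq[]. Qed.

Lemma component_eq u C D x : component u C -> component u D -> C x -> D x -> C = D.
Proof.
move=> [c [_ ->]] [d [_ ->]] cx dx; have cd := avoid_conn_trans cx (avoid_conn_sym dx).
apply/seteqP; split => z; first exact: avoid_conn_trans (avoid_conn_sym cd).
exact: avoid_conn_trans cd.
Qed.

(* Lists of sites with latest addition first, grown from the root by leaves. *)
Fixpoint grow s : bool :=
  if s is v :: s' then
    [&& grow s', v \notin s' & (v == root) || (pa v \in s')]
  else true.

Lemma grow_uniq s : grow s -> uniq s.
Proof. by elim: s => //= v s IHs /and3P[/IHs-> ->]. Qed.

Lemma grow_pa s v : grow s -> v \in s -> v != root -> pa v \in s.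
Proof.
elim: s => //= w s IHs /and3P[gs _ ws]; rewrite !inE => /orP[/eqP->|vs] v0.
  by rewrite (negbTE v0) /= in ws; rewrite ws orbT.
by rewrite IHs ?orbT.
Qed.

(** Each site is added after its ancestors, by induction along the path from the root. *)
Lemma grow_cover (V : seq (site r)) : exists2 s, grow s & {subset V <= s}.
Proof.
have add v s : grow s -> exists2 t, grow t & v \in t /\ {subset s <= t}.
  elim/site_ind: v => [|v v0 IHv] gs.
    case: (boolP (root \in s)) => rs; first by exists s => //; split=> // x.
    exists (root :: s); first by apply/and3P; rewrite eqxx.
    by split=> [|x xs]; rewrite inE ?eqxx ?xs ?orbT.
  have [t gt [pt st]] := IHv gs.
  case: (boolP (v \in t)) => vt; first by exists t => //; split=> // x /st.
  exists (v :: t); first by rewrite /= gt vt pt orbT.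
  by split=> [|x /st xs]; rewrite inE ?eqxx ?xs ?orbT.
elim: V => [|v V [s gs Vs]]; first by exists [::].
have [t gt [vt st]] := add v s gs; exists t => // x.
by rewrite inE => /orP[/eqP->//|/Vs/st].
Qed.

(** [s] is closed under parents, so a descendant of [v] in [s] would bring [v] itself into [s]. *)
Lemma grow_leaf s v y : grow (v :: s) -> y \in s -> ~~ prefix_of v y.
Proof.
case/and3P=> gs vs _; elim/site_ind: y => [|y y0 IHy] ys.
  apply: contraNN vs => /eqP /= v0; suff -> : v = root by [].
  exact: val_inj.
have yv : y != v by apply: contraNneq vs => <-.
by rewrite (prefix_of_child y0 erefl yv) IHy ?grow_pa.
Qed.

End Tree.

(** * Automorphisms of the tree and transitivity on oriented edges *)

Section Automorphisms.
Variable r : nat.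
Implicit Types (u v x y : site r) (a b : 'I_r.+1) (g : site r -> site r).

Lemma tree_aut_comp g1 g2 : tree_aut g1 -> tree_aut g2 -> tree_aut (g1 \o g2).
Proof.
move=> [b1 t1] [b2 t2]; split=> [|x y /=]; first exact: bij_comp.
by rewrite t1 t2.
Qed.

Lemma tree_aut_inv g : tree_aut g ->
  exists g', [/\ tree_aut g', cancel g g' & cancel g' g].
Proof.
move=> [[g' gK g'K] tg]; exists g'; split=> //; split; first by exists g.
by move=> x y; rewrite -tg !g'K.
Qed.

Lemma avoid_conn_aut g u x y : tree_aut g ->
  avoid_conn u x y -> avoid_conn (g u) (g x) (g y).
Proof.
move=> [/bij_inj gI tg] xy; have [xu _] := avoid_conn_neq xy.
move: y xy; apply: (@avoid_conn_ind _ u (fun y => avoid_conn (g u) (g x) (g y))).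
  by apply: avoid_conn_refl; rewrite (inj_eq gI).
move=> y z yu zu yz xy; apply: avoid_conn_trans xy _.
by apply: avoid_conn_tadj; rewrite ?(inj_eq gI) ?tg.
Qed.

Lemma component_aut g u C : tree_aut g ->
  component u C -> component (g u) (g @` C).
Proof.
move=> ga [x [xu ->]]; have [g' [ga' gK g'K]] := tree_aut_inv ga.
exists (g x); split; first by case: ga => /bij_inj gI _; rewrite (inj_eq gI).
apply/seteqP; split=> [_ [y xy <-]|y]; first exact: avoid_conn_aut.
move=> /(avoid_conn_aut ga'); by rewrite !gK => xy; exists (g' y).
Qed.

(* Left multiplication by the generator [a] in the free product. *)
Definition flip_word a (w : seq 'I_r.+1) :=
  if w is b :: w' then if b == a then w' else a :: w else [:: a].

Lemma flip_word_reduced a w : reducedw w -> reducedw (flip_word a w).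
Proof.
case: w => [|b w] //=; case: eqVneq => [_|ba]; last first.
  by move=> bw; rewrite /reducedw /= eq_sym ba.
by case: w => //= c w; rewrite /reducedw /= => /andP[].
Qed.

Definition flip a v : site r := Sub (flip_word a (val v)) (flip_word_reduced a (valP v)).

Lemma flipK a : involutive (flip a).
Proof.
move=> v; apply: val_inj => /=; case: v => -[|b w] /= vw; first by rewrite eqxx.
case: (eqVneq b a) vw => [->|ba] vw /=; last by rewrite eqxx.
by case: w vw => [|c w]; rewrite /reducedw //= => /andP[bc _]; rewrite eq_sym (negbTE bc).
Qed.

(** [flip a] acts on the front of a word and [pa] on its end; they interfere only at the two ends of
    the edge that [flip a] reverses. *)
Lemma pa_flip a v : v != root r -> val v != [:: a] -> pa (flip a v) = flip a (pa v).
Proof.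
move=> v0 va; apply: val_inj; rewrite val_pa /= val_pa.
case: v v0 va => -[|b [|c w]] //= vw _.
  by rewrite eqseq_cons andbT => /negbTE->.
by move=> _; case: eqVneq => /=.
Qed.

Lemma flip_aut a : tree_aut (flip a).
Proof.
have H u v : tadj u v -> tadj (flip a u) (flip a v).
  wlog : u v / v != root r /\ u = pa v.
    move=> H uv; move: (uv); rewrite tadjE => /orP[] /andP[z0 /eqP zE].
      exact: H.
    by rewrite tadjC; apply: H; rewrite // tadjC.
  move=> [v0 ->] _; case: (eqVneq (val v) [:: a]) => va.
    have pv : pa v = root r by apply: val_inj; rewrite val_pa va.
    rewrite tadjE pv; apply/orP; right; apply/andP; split => //.
    by apply/eqP/val_inj; rewrite val_pa /= va /= eqxx.
  rewrite -pa_flip //; apply: tadj_pa; apply: contraNneq va => fv.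
  by rewrite -(flipK a v) fv.
split; first by exists (flip a); exact: flipK.
by move=> x y; apply/idP/idP => /H //; rewrite !flipK.
Qed.

Definition permute_word (s : {perm 'I_r.+1}) v : site r :=
  insubd (root r) [seq s a | a <- val v].

Lemma val_permute_word s v : val (permute_word s v) = [seq s a | a <- val v].
Proof.
rewrite val_insubd; case: ifP => // /negP[].
case: v => w /= rw; rewrite /reducedw sorted_map /=.
by apply: sub_sorted rw => a b /=; rewrite (inj_eq perm_inj).
Qed.

Lemma permute_word_aut s : tree_aut (permute_word s).
Proof.
have sK (s1 s2 : {perm 'I_r.+1}) : cancel s1 s2 ->
    cancel (permute_word s1) (permute_word s2).
  by move=> K v; apply: val_inj; rewrite !val_permute_word mapK.
split; first by exists (permute_word s^-1%g); apply: sK => a; rewrite ?permK ?permKV.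
move=> x y; rewrite /tadj /child !val_permute_word !size_map -!map_take.
by rewrite !(inj_eq (inj_map perm_inj)).
Qed.

(** Permuting letters reaches every edge out of the root, and [flip a] reverses the edge to
    [[:: a]]. Further edges are brought closer to the root by flipping away the first letter. Both
    orientations go through the induction together. *)
Lemma tree_aut_edge u v : tadj u v ->
  exists g, [/\ tree_aut g, g (root r) = u & g (ext (root r) ord0) = v].
Proof.
pose Q u v := exists g, [/\ tree_aut g, g (root r) = u & g (ext (root r) ord0) = v].
have Qaut g x y : tree_aut g -> Q x y -> Q (g x) (g y).
  move=> ga [g1 [ga1 <- <-]]; exists (g \o g1); split=> //.
  exact: tree_aut_comp.
have e0 a : val (ext (root r) a) = [:: a] by rewrite val_ext.
suff QQ y : y != root r -> Q (pa y) y /\ Q y (pa y).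
  by rewrite tadjE => /orP[] /andP[/QQ[H1 H2] /eqP->].
have base a : Q (root r) (ext (root r) a) /\ Q (ext (root r) a) (root r).
  have Q1 : Q (root r) (ext (root r) a).
    exists (permute_word (tperm ord0 a)); split; first exact: permute_word_aut.
      by apply: val_inj; rewrite val_permute_word.
    by apply: val_inj; rewrite val_permute_word !e0 /= tpermL.
  split=> //; have := Qaut _ _ _ (flip_aut a) Q1.
  have -> : flip a (root r) = ext (root r) a by apply: val_inj; rewrite e0.
  suff -> : flip a (ext (root r) a) = root r by [].
  by apply: val_inj; rewrite /= e0 /= eqxx.
move: {2}(val y) (erefl (val y)) => w; elim: w y => [|a w IHw] y yw y0.
  by case/eqP: y0; apply: val_inj.
case: (eqVneq w [::]) => w0.
  have -> : y = ext (root r) a by apply: val_inj; rewrite e0 yw w0.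
  by rewrite pa_ext.
have fy : val (flip a y) = w by rewrite /= yw /= eqxx.
have fy0 : flip a y != root r by rewrite -val_eqE fy.
have fya : val (flip a y) != [:: a].
  rewrite fy; apply/eqP => wa; have := valP y; rewrite /= yw wa /reducedw /=.
  by rewrite eqxx.
have [Q1 Q2] := IHw _ fy fy0.
have := Qaut _ _ _ (flip_aut a) Q1; have := Qaut _ _ _ (flip_aut a) Q2.
by rewrite -pa_flip // flipK.
Qed.

End Automorphisms.

(** * Cylinders *)

Section Cylinders.
Variables (R : realType) (r n : nat).
Implicit Types (a b : site r -> 'I_n.+1) (V s : seq (site r)) (D : set (site r)).

Definition cyl V a : set (Cfg r n) :=
  [set phi : site r -> 'I_n.+1 | forall v, v \in V -> phi v = a v].

Lemma eq_cyl V V' a b : V =i V' -> (forall v, v \in V -> a v = b v) ->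
  cyl V a = cyl V' b.
Proof.
move=> VV ab; apply/seteqP; split=> phi aphi v vV.
  by rewrite -ab ?aphi // VV.
by rewrite aphi -?VV ?ab.
Qed.

Lemma cyl_nil a : cyl [::] a = setT.
Proof. by apply/seteqP; split. Qed.

Lemma cyl_cons v V a : cyl (v :: V) a = [set phi | phi v = a v] `&` cyl V a.
Proof.
apply/seteqP; split=> [phi pa|phi [pv pa] w].
  by split=> [|w wV]; apply: pa; rewrite inE ?eqxx ?wV ?orbT.
by rewrite inE => /orP[/eqP->|/pa].
Qed.

Lemma cyl_cat V V' a : cyl (V ++ V') a = cyl V a `&` cyl V' a.
Proof.
elim: V => [|v V IHV] /=; first by rewrite cyl_nil setTI.
by rewrite !cyl_cons IHV setIA.
Qed.

Lemma cyl_sigma D V a : (forall v, v \in V -> D v) ->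
  <<s @cyl_on r n D >> (cyl V a).
Proof.
elim: V => [_|v V IHV VD].
  by rewrite cyl_nil; exact: (@measurableT _ (g_sigma_algebraType (cyl_on D))).
rewrite cyl_cons; apply: (@measurableI _ (g_sigma_algebraType (@cyl_on r n D))).
  by apply: sub_sigma_algebra; exists v, (a v); split=> //; apply: VD; rewrite inE eqxx.
by apply: IHV => w wV; apply: VD; rewrite inE wV orbT.
Qed.

Lemma measurable_cyl V a : measurable (cyl V a).
Proof. exact: cyl_sigma. Qed.

Lemma sub_cyl_sigma D D' : D `<=` D' ->
  <<s @cyl_on r n D >> `<=` <<s @cyl_on r n D' >>.
Proof.
by move=> DD; apply: sub_sigma_algebra2 => A [v [i [/DD vD ->]]]; exists v, i.
Qed.

Lemma cyl_sigma_measurable D (A : set (Cfg r n)) :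
  <<s @cyl_on r n D >> A -> measurable A.
Proof. exact: sub_cyl_sigma. Qed.

Lemma cyl_coord v i : [set phi : Cfg r n | phi v = i] = cyl [:: v] (fun=> i).
Proof. by rewrite cyl_cons cyl_nil setIT. Qed.

Lemma measurable_coord v i : measurable [set phi : Cfg r n | phi v = i].
Proof. by rewrite cyl_coord; exact: measurable_cyl. Qed.

Lemma glue_in (U : {fset site r}) (xi : {ffun U -> 'I_n.+1}) a (u : U) :
  glue xi a (val u) = xi u.
Proof. by rewrite /glue valK. Qed.

Lemma glue_notin (U : {fset site r}) (xi : {ffun U -> 'I_n.+1}) a v :
  v \notin U -> glue xi a v = a v.
Proof. by move=> vU; rewrite /glue insubN. Qed.

Lemma cyl_marginal (m : {measure set (Cfg r n) -> \bar R}) (U : {fset site r}) s b :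
  (forall v, v \in U -> v \notin s) ->
  (m (cyl s b) = \sum_(xi : {ffun U -> 'I_n.+1}) m (cyl (U ++ s) (glue xi b)))%E.
Proof.
move=> Us; have -> : cyl s b = \bigcup_(xi in [set: {ffun U -> 'I_n.+1}])
    cyl (U ++ s) (glue xi b).
  apply/seteqP; split=> [phi pb|phi [xi _] pxi v vs].
    exists [ffun u => phi (val u)] => // v.
    rewrite mem_cat; case: (boolP (v \in U)) => [vU _|vU /= vs].
      by rewrite -[v]/(val [` vU]%fset) glue_in ffunE.
    by rewrite glue_notin // pb.
  rewrite pxi ?mem_cat ?vs ?orbT // glue_notin //.
  by apply/negP => /Us; rewrite vs.
rewrite measure_fin_bigcup.
- have -> : [set: {ffun U -> 'I_n.+1}] = [set` index_enum {ffun U -> 'I_n.+1}].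
    by apply/seteqP; split=> // xi _ /=; exact: mem_index_enum.
  by rewrite -fsbig_seq ?index_enum_uniq.
- exact: finite_finset.
- move=> xi xi' _ _ [phi [p1 p2]]; apply/ffunP => u.
  have uU : val u \in U ++ s by rewrite mem_cat (valP u).
  by rewrite -(glue_in xi b) -(glue_in xi' b) -p1 // -p2.
- by move=> xi _; exact: measurable_cyl.
Qed.

Lemma prob_cyl_marginal (mu : probability (Cfg r n) R) (U : {fset site r}) s b :
  (forall v, v \in U -> v \notin s) ->
  (mu (cyl s b) = \sum_(xi : {ffun U -> 'I_n.+1}) mu (cyl (U ++ s) (glue xi b)))%E.
Proof. exact: cyl_marginal. Qed.

Lemma cyl_measure_sub (m1 m2 : {measure set (Cfg r n) -> \bar R}) V V' :
  {subset V <= V'} -> (forall a, m1 (cyl V' a) = m2 (cyl V' a)) ->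
  forall a, m1 (cyl V a) = m2 (cyl V a).
Proof.
move=> VV mm a; pose U := [fset v in V' | v \notin V]%fset.
have UV v : v \in U -> v \notin V by rewrite !inE => /andP[].
rewrite !(@cyl_marginal _ U V) //; apply: eq_bigr => xi _.
have -> : cyl (U ++ V) (glue xi a) = cyl V' (glue xi a) => //.
apply: eq_cyl => // v; rewrite mem_cat !inE /=; case: (boolP (v \in V)) => [/VV->|].
  by rewrite orbT.
by rewrite orbF andbT.
Qed.

(** Cylinders together with the empty set are closed under intersection and generate the
    sigma-algebra. Agreement is asked only on some larger set of sites for each [V], since it
    descends to [V] by summation; this lets [V'] be chosen conveniently, for instance as a list
    closed under parents. *)
Lemma cyl_measure_eq D (m1 m2 : {measure set (Cfg r n) -> \bar R}) :
  (m1 setT < +oo)%E ->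
  (forall V, (forall v, v \in V -> D v) -> exists V',
    [/\ {subset V <= V'}, forall v, v \in V' -> D v &
        forall a, m1 (cyl V' a) = m2 (cyl V' a)]) ->
  forall B, <<s @cyl_on r n D >> B -> m1 B = m2 B.
Proof.
move=> m1oo agree.
pose G := [set A | A = set0 \/ exists V a, (forall v, v \in V -> D v) /\ A = cyl V a].
have sDG : <<s @cyl_on r n D >> `<=` <<s G >>.
  apply: sub_sigma_algebra2 => A [v [i [vD ->]]]; right; exists [:: v], (fun=> i).
  split; last exact: cyl_coord.
  by move=> w; rewrite inE => /eqP->.
move=> B /sDG; apply: (g_sigma_algebra_measure_unique G _ (fun=> setT)) => //.
- by move=> A [->|[V [a [_ ->]]]] //; exact: measurable_cyl.
- by move=> _; right; exists [::], (fun=> ord0); rewrite cyl_nil.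
- by rewrite bigcup_const //; exists 0%N.
- move=> A A' [->|[V [a [VD ->]]]]; first by rewrite set0I; left.
  move=> [->|[V' [a' [VD' ->]]]]; first by rewrite setI0; left.
  have [->|/set0P[psi [p1 p2]]] := eqVneq (cyl V a `&` cyl V' a') set0; first by left.
  right; exists (V ++ V'), psi; split.
    by move=> v; rewrite mem_cat => /orP[/VD|/VD'].
  rewrite cyl_cat; congr (_ `&` _); apply: eq_cyl => // v vV.
    by rewrite p1.
  by rewrite p2.
- move=> A [->|[V [a [VD ->]]]]; first by rewrite !measure0.
  have [V' [VV VD' mm]] := agree V VD.
  exact: cyl_measure_sub VV mm a.
Qed.

Lemma determined_measurable (V : {fset site r}) (A : set (Cfg r n)) :
  (forall phi psi : site r -> 'I_n.+1, (forall v, v \in V -> phi v = psi v) ->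
     A phi -> A psi) -> measurable A.
Proof.
move=> VA; pose pt (xi : {ffun V -> 'I_n.+1}) := glue xi (fun=> ord0).
have -> : A = \bigcup_(xi in [set xi | A (pt xi)]) cyl V (pt xi).
  apply/seteqP; split=> [phi Aphi|phi [xi Axi] pxi].
    have E v : v \in V -> phi v = pt [ffun u => phi (val u)] v.
      by move=> vV; rewrite -[v]/(val [` vV]%fset) /pt glue_in ffunE.
    exists [ffun u => phi (val u)] => //=; exact: VA Aphi.
  by apply: VA Axi => v /pxi ->.
by apply: fin_bigcup_measurable => [|xi _]; [exact: finite_finset|exact: measurable_cyl].
Qed.

End Cylinders.

(** * Tree-indexed Markov chains *)

Lemma pushforward_probability d d' (T : measurableType d) (T' : measurableType d')
    (R : realType) (P : probability T R) (f : T -> T') :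
  measurable_fun setT f ->
  exists Q : probability T' R, forall A, Q A = P (f @^-1` A).
Proof.
move=> mf; pose F : {mfun T >-> T'} := HB.pack f (isMeasurableFun.Build _ _ _ _ f mf).
by exists (distribution P F).
Qed.

(** * A process with prescribed finite-dimensional laws on the unit interval *)

Section IntervalProcess.
Variables (R : realType) (n : nat) (p : seq 'I_n.+1 -> R).
Hypotheses (p0 : forall t, 0 <= p t) (p1 : p [::] = 1).
Hypothesis pS : forall t, p t = \sum_i p (i :: t).
Implicit Types (t : seq 'I_n.+1) (i : 'I_n.+1) (x : R).

(* Histories are written latest value first; the interval of [t], of length
   [p t], is cut into consecutive intervals, one for each [i :: t]. *)
Fixpoint left_end t : R :=
  if t is i :: t' then left_end t' + \sum_(j < n.+1 | (j < i)%N) p (j :: t') else 0.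

Definition in_itv_of x t := left_end t <= x < left_end t + p t.

Definition next_value x t : 'I_n.+1 :=
  odflt ord0 [pick i | in_itv_of x (i :: t)].

Fixpoint history x k : seq 'I_n.+1 :=
  if k is k'.+1 then next_value x (history x k') :: history x k' else [::].

Let psum t (k : nat) : R := \sum_(j < n.+1 | (j < k)%N) p (j :: t).

Let psumS t i : psum t i.+1 = psum t i + p (i :: t).
Proof.
rewrite /psum (bigD1 i) //= addrC; congr (_ + _); apply: eq_bigl => j.
by rewrite ltnS ltn_neqAle andbC.
Qed.

Let psum_le t k k' : (k <= k')%N -> psum t k <= psum t k'.
Proof.
move=> kk; rewrite /psum [X in _ <= X](bigID (fun j : 'I_n.+1 => (j < k)%N)) /=.
rewrite [X in _ <= X + _](eq_bigl (fun j : 'I_n.+1 => (j < k)%N)).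
  by rewrite lerDl sumr_ge0.
by move=> j; rewrite andb_idl // => /leq_trans ->.
Qed.

Let psum_all t : psum t n.+1 = p t.
Proof. by rewrite pS /psum; apply: eq_bigl => j; rewrite ltn_ord. Qed.

Let in_itv_consE x i t :
  in_itv_of x (i :: t) = (left_end t + psum t i <= x < left_end t + psum t i.+1).
Proof. by rewrite /in_itv_of /= psumS addrA. Qed.

Lemma in_itv_split x t : in_itv_of x t = [exists i, in_itv_of x (i :: t)].
Proof.
apply/idP/existsP => [/andP[x0 x1]|[i]]; last first.
  rewrite in_itv_consE => /andP[x0 x1]; apply/andP; split.
    by apply: le_trans x0; rewrite lerDl sumr_ge0.
  by apply: (lt_le_trans x1); rewrite lerD2l -psum_all; exact: psum_le.
(* The first partial sum that passes [x] ends the interval containing [x]; by minimality the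
   previous one does not pass it. *)
have ex : exists k, x < left_end t + psum t k.
  by exists n.+1; rewrite psum_all.
pose k := ex_minn ex; have [xk kmin] : x < left_end t + psum t k /\
    forall m, x < left_end t + psum t m -> (k <= m)%N.
  by rewrite /k; case: ex_minnP.
have kn : (k <= n.+1)%N by apply: kmin; rewrite psum_all.
case: k xk kmin kn => [|k] xk kmin kn.
  by move: xk; rewrite /psum big_pred0 // addr0 ltNge x0.
exists (Ordinal kn); rewrite in_itv_consE /= xk andbT leNgt; apply/negP => /kmin.
by rewrite ltnn.
Qed.

Lemma in_itv_inj x t i j : in_itv_of x (i :: t) -> in_itv_of x (j :: t) -> i = j.
Proof.
rewrite !in_itv_consE => /andP[xi0 xi1] /andP[xj0 xj1].
case: (ltngtP i j) => [ij|ij|/val_inj //].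
  by have := lt_le_trans xi1 (le_trans (lerD (lexx _) (psum_le t ij)) xj0); rewrite ltxx.
by have := lt_le_trans xj1 (le_trans (lerD (lexx _) (psum_le t ij)) xi0); rewrite ltxx.
Qed.

Lemma historyP x k t : size t = k -> 0 <= x < 1 -> (history x k == t) = in_itv_of x t.
Proof.
move=> + x01; elim: k t => [|k IHk] t.
  by move/size0nil=> ->; rewrite /in_itv_of /= p1 add0r x01 eqxx.
case: t => // i t [tk]; rewrite /= eqseq_cons IHk //.
apply/andP/idP => [[/eqP ni]|iti].
  rewrite in_itv_split => /existsP[j jt]; rewrite -ni /next_value.
  case: eqP (IHk t tk) => [ht _|_]; last first.
    by rewrite in_itv_split; case: existsP => // -[]; exists j.
  by rewrite ht; case: pickP => [//|/(_ j)]; rewrite jt.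
have it : in_itv_of x t by rewrite in_itv_split; apply/existsP; exists i.
split=> //; have /eqP -> : history x k == t by rewrite IHk.
rewrite /next_value; case: pickP => [j jt|/(_ i)]; last by rewrite iti.
by apply/eqP/(in_itv_inj jt).
Qed.

Lemma in_itv_sub01 x t : in_itv_of x t -> 0 <= x < 1.
Proof.
elim: t => [|i t IHt]; first by rewrite /in_itv_of /= p1 add0r.
by move=> it; apply: IHt; rewrite in_itv_split; apply/existsP; exists i.
Qed.

Lemma history_out x k : ~~ (0 <= x < 1) -> history x k = nseq k ord0.
Proof.
move=> x01; have out t : ~~ in_itv_of x t by apply: contra x01; exact: in_itv_sub01.
elim: k => //= k ->; congr (_ :: _); rewrite /next_value.
by case: pickP => // i; rewrite (negbTE (out _)).
Qed.

(** Outside [[0, 1[] no interval contains [x] and [next_value] falls back on [ord0], so the constant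
    history gets the complement as an extra piece. *)
Lemma history_setE k t : size t = k ->
  [set x | history x k = t] = `[left_end t, left_end t + p t[ `|`
    (if t == nseq k ord0 then ~` `[0, 1[ else set0).
Proof.
move=> tk; apply/seteqP; split=> x /=.
  move=> xt; case: (boolP (0 <= x < 1)) => x01.
    by left; rewrite in_itv /= -/(in_itv_of x t) -(historyP tk) // xt.
  by right; rewrite -xt history_out // eqxx /= in_itv /=; apply/negP.
case=> [xt|].
  have it : in_itv_of x t by move: xt; rewrite in_itv.
  by apply/eqP; rewrite (historyP tk (in_itv_sub01 it)).
case: eqP => // -> /=; rewrite in_itv /= => /negP x01.
exact: history_out.
Qed.

Lemma measurable_history k (A : set (seq 'I_n.+1)) :
  measurable [set x : measurableTypeR R | A (history x k)].
Proof.
have m1 t : measurable [set x : measurableTypeR R | history x k = t].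
  case: (eqVneq (size t) k) => tk.
    rewrite (history_setE tk); apply: measurableU; first exact: measurable_itv.
    by case: ifP => _ //; apply: measurableC; exact: measurable_itv.
  rewrite (_ : [set x | _] = set0) //; apply/seteqP; split=> // x /= xt.
  case/eqP: tk; rewrite -xt; by elim: k {xt} => //= m ->.
pose F (o : option (seq 'I_n.+1)) : set (measurableTypeR R) :=
  if o is Some t then if `[< A t >] then [set x | history x k = t] else set0
  else set0.
have mF o : measurable (F o).
  by case: o => [t|] /=; [case: asboolP => _|]; [exact: m1|exact: measurable0..].
have -> : [set x | A (history x k)] = \bigcup_m F (choice.unpickle m).
  apply/seteqP; split=> [x Ax|x [m _]].
    exists (choice.pickle (history x k)) => //.
    by rewrite choice.pickleK /F; case: asboolP.
  by rewrite /F; case: (choice.unpickle m) => // t; case: asboolP => // At /= ->.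
by apply: bigcupT_measurable => m; exact: mF.
Qed.

(** Lebesgue measure restricted to [[0, 1[] removes that extra piece, and the interval of [t] has
    length [p t]; for [p t = 0] it is empty. *)
Lemma interval_process : exists (Q : probability (measurableTypeR R) R),
  forall k t, size t = k -> Q [set x | history x k = t] = (p t)%:E.
Proof.
have mI : measurable (`[0, 1[%classic : set (measurableTypeR R)).
  exact: measurable_itv.
pose m := mrestr (@lebesgue_measure R) mI.
have m1 : m setT = 1%:E.
  by rewrite /m /mrestr setTI lebesgue_measure_itv /= lte_fin ltr01 oppr0 adde0.
pose Q : probability (measurableTypeR R) R :=
  HB.pack m (Measure_isProbability.Build _ _ _ m m1).
exists Q => k t tk; rewrite -[LHS]/(m _) /m /mrestr.
have -> : [set x | history x k = t] `&` `[0, 1[ = `[left_end t, left_end t + p t[%classic.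
  rewrite (history_setE tk) setIUl [X in _ `|` X](_ : _ = set0) ?setU0.
    by rewrite setIidl // => x /=; rewrite !in_itv; exact: in_itv_sub01.
  by case: ifP => _; rewrite ?set0I // setICl.
rewrite lebesgue_measure_itv /= lte_fin ltrDl; case: ifPn.
  by rewrite -EFinB addrAC subrr add0r.
by rewrite -leNgt => pt; congr _%:E; apply/esym/eqP; rewrite eq_le pt p0.
Qed.
End IntervalProcess.

(** * An enumeration of all sites with parents first *)

Section Enumeration.
Variable r : nat.
Hypothesis r1 : (1 <= r)%N.
Implicit Types (v w : site r) (s : seq (site r)).

(* Bijective numeration in base [r + 1], so that parents have smaller codes. *)
Definition word_code (s : seq 'I_r.+1) : nat :=
  foldl (fun c (a : 'I_r.+1) => c * r.+1 + a.+1)%N 0%N s.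

Lemma word_code_rcons (s : seq 'I_r.+1) a :
  word_code (rcons s a) = (word_code s * r.+1 + a.+1)%N.
Proof. by rewrite /word_code foldl_rcons. Qed.

Lemma word_code_inj : injective word_code.
Proof.
elim/last_ind => [|s a IHs] s'; case/lastP: s' => [|s' a'] //;
  rewrite !word_code_rcons ?addnS // => -[E].
have aE : a = a' :> nat.
  by have := congr1 (modn^~ r.+1) E; rewrite !modnMDl !modn_small.
move: E; rewrite aE => /addIn /eqP; rewrite eqn_pmul2r // => /eqP /IHs ->.
by congr rcons; apply: val_inj.
Qed.

Lemma code_pa v : v != root r -> (word_code (val (pa v)) < word_code (val v))%N.
Proof.
move=> v0; rewrite [X in (_ < word_code X)%N](site_rcons v0) word_code_rcons.
by rewrite addnS ltnS (leq_trans _ (leq_addr _ _)) // leq_pmulr.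
Qed.

(** Words alternating between [ord0] and [ord_max], distinct letters as [1 <= r], are reduced and
    arbitrarily long. *)
Lemma fresh_site s : exists v, v \notin s.
Proof.
pose alt k : seq 'I_r.+1 := 
    iter k (fun t : seq 'I_r.+1 => (if head ord0 t == ord0 then ord_max else ord0) :: t) [::].
have altr k : reducedw (alt k).
  elim: k => // k IHk; rewrite /reducedw /=; case: (alt k) IHk => //= a w aw.
  rewrite aw andbT; case: (eqVneq a ord0) => [->|]; last by rewrite eq_sym.
  by rewrite -val_eqE /= -lt0n.
pose m := \max_(v <- s) size (val v).
exists (Sub (alt m.+1) (altr m.+1)); apply/negP => vs.
have := leq_bigmax_seq (P := xpredT) (F := fun v : site r => size (val v)) _ vs isT.
rewrite -/m /= (_ : forall k, size (alt k) = k) ?ltnn //.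
by elim=> //= k ->.
Qed.

Lemma next_site_ex s : exists v, v \notin s /\
  forall w, w \notin s -> (word_code (val v) <= word_code (val w))%N.
Proof.
have ex : exists c, `[< exists2 v, v \notin s & word_code (val v) = c >].
  by have [v vs] := fresh_site s; exists (word_code (val v)); apply/asboolP; exists v.
case: (ex_minnP ex) => c /asboolP[v vs vc] cmin; exists v; split=> // w ws.
by rewrite vc; apply: cmin; apply/asboolP; exists w.
Qed.

Definition next_site s : site r := projT1 (cid (next_site_ex s)).

Fixpoint site_enum (k : nat) : seq (site r) :=
  if k is k'.+1 then next_site (site_enum k') :: site_enum k' else [::].

Lemma size_site_enum k : size (site_enum k) = k.
Proof. by elim: k => //= k ->. Qed.

Lemma next_siteP s : next_site s \notin s /\
  forall w, w \notin s -> (word_code (val (next_site s)) <= word_code (val w))%N.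
Proof. exact: (projT2 (cid (next_site_ex s))). Qed.

Lemma grow_site_enum k : grow (site_enum k).
Proof.
elim: k => //= k ->; have [-> vmin] := next_siteP (site_enum k) => /=.
case: eqVneq => //= v0; apply: contraTT (code_pa v0) => /vmin.
by rewrite -leqNgt.
Qed.

(** Each round takes the least code still available. Were [v], of code [c], missing after [c.+1]
    rounds, the [c.+1] listed sites would have distinct codes below [c]. *)
Lemma site_enum_cover v : v \in site_enum (word_code (val v)).+1.
Proof.
apply/negPn/negP => vs; set c := word_code (val v) in vs *.
have small k : v \notin site_enum k ->
    {subset [seq word_code (val w) | w <- site_enum k] <= iota 0 c}.
  move=> + x /mapP[w wk ->]; elim: k wk => //= k IHk wk.
  rewrite inE negb_or => /andP[vn vk]; move: wk; rewrite inE => /orP[/eqP wE|wk].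
    have [_ /(_ v vk)] := next_siteP (site_enum k); rewrite -wE -/c leq_eqVlt mem_iota add0n.
    case/orP=> // /eqP /word_code_inj /val_inj wv.
    by rewrite -wE wv eqxx in vn.
  exact: IHk.
have := uniq_leq_size _ (small _ vs); rewrite size_map size_site_enum size_iota ltnn.
move=> H; suff: false by []; apply: H; rewrite map_inj_uniq ?grow_uniq ?grow_site_enum //.
by move=> x y /word_code_inj /val_inj.
Qed.

End Enumeration.

(** * Existence of the Markov chain indexed by the tree *)

Section Chain.
Variables (R : realType) (r n : nat) (pi : 'I_n.+1 -> R) (P : 'I_n.+1 -> 'I_n.+1 -> R).
Implicit Types (a b : site r -> 'I_n.+1) (v : site r) (s : seq (site r)).

Definition step_wt a v : R := if v == root r then pi (a v) else P (a (pa v)) (a v).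

Definition chain_wt s a : R := \prod_(v <- s) step_wt a v.

Lemma eq_chain_wt s a b : grow s -> {in s, a =1 b} -> chain_wt s a = chain_wt s b.
Proof.
move=> gs ab; rewrite /chain_wt !big_seq; apply: eq_bigr => v vs.
rewrite /step_wt ab //; case: eqP => // /eqP v0.
by rewrite ab // grow_pa.
Qed.

Hypotheses (pi0 : forall i, 0 <= pi i) (pi1 : \sum_i pi i = 1).
Hypotheses (P0 : forall i j, 0 <= P i j) (P1 : forall i, \sum_j P i j = 1).

(** Along the enumeration the parent of a new site has been read already, so the rows of [P] summing
    to 1 make the chain weights a consistent family on histories. The interval process realises it,
    and its image on configurations is [mu]; arbitrary grown lists are then obtained by summing over
    the other enumerated sites. *)
Lemma chain_exists : (1 <= r)%N -> exists mu : probability (Cfg r n) R,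
  forall s a, grow s -> mu (cyl s a) = (chain_wt s a)%:E.
Proof.
move=> r1; pose G k := site_enum r1 k.
(* Histories and [G] both have the latest entry first, so positions match; sites not yet listed read
   as [ord0]. *)
pose read (t : seq 'I_n.+1) v := nth ord0 t (index v (G (size t))).
pose p t := chain_wt (G (size t)) (read t).
have p0 t : 0 <= p t.
  by apply: prodr_ge0 => v _; rewrite /step_wt; case: ifP.
have p1 : p [::] = 1 by rewrite /p /chain_wt big_nil.
have readG a k : {in G k, read [seq a v | v <- G k] =1 a}.
  move=> v vk; rewrite /read size_map size_site_enum (nth_map v) ?index_mem //.
  by rewrite nth_index.
have pG a k : p [seq a v | v <- G k] = chain_wt (G k) a.
  rewrite /p size_map size_site_enum; apply: eq_chain_wt; first exact: grow_site_enum.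
  exact: readG.
have pcons i t : p (i :: t) = step_wt (read (i :: t)) (next_site r1 (G (size t))) * p t.
  rewrite /p /chain_wt /= big_cons; congr (_ * _).
  apply: eq_chain_wt; first exact: grow_site_enum.
  move=> v vk; rewrite /read /=; case: eqVneq => // vE.
  by have [] := next_siteP r1 (G (size t)); rewrite vE vk.
have pS t : p t = \sum_i p (i :: t).
  under eq_bigr do rewrite pcons; rewrite -mulr_suml -[LHS]mul1r; congr (_ * _).
  set v := next_site r1 _.
  have rv i : read (i :: t) v = i by rewrite /read /= eqxx.
  rewrite /step_wt; case: eqP => [_|/eqP v0].
    by under eq_bigr do rewrite rv.
  have pv : pa v \in G (size t).
    have := grow_site_enum r1 (size t).+1; rewrite /= => /and3P[_ _].
    by rewrite -/v (negbTE v0).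
  rewrite -[LHS](P1 (read t (pa v))); apply: eq_bigr => i _; rewrite rv; congr (P _ _).
  rewrite /read /= -/v; case: eqVneq => // vE.
  by have [] := next_siteP r1 (G (size t)); rewrite -/v vE pv.
have [Q QE] := interval_process p0 p1 pS.
(* Reversing [G] turns the position into the order of appearance, and by [site_enum_cover] that many
   rounds suffice. The value at [v] is then the head of the history one step after [stage v]. *)
pose stage v := index v (rev (G (word_code (val v)).+1)).
pose phi x : Cfg r n := fun v => head ord0 (history p x (stage v).+1).
have stageG k : stage (next_site r1 (G k)) = k.
  rewrite /stage; set v := next_site _ _.
  have rG l : exists q, rev (G (k + l).+1) = rcons (rev (G k)) v ++ q.
    elim: l => [|l [q Eq]]; first by exists [::]; rewrite addn0 cats0 /= rev_cons.
    by exists (rcons q (next_site r1 (G (k + l).+1))); rewrite addnS [LHS]rev_cons Eq rcons_cat.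
  have vc : (k <= word_code (val v))%N.
    rewrite leqNgt; apply/negP => ck.
    have : v \in G k.
      rewrite /G -(subnK ck); elim: (_ - _)%N => [|m IHm]; first exact: site_enum_cover.
      by rewrite addSn inE IHm orbT.
    by case: (next_siteP r1 (G k)) => /negbTE; rewrite -/v => ->.
  have [q] := rG (word_code (val v) - k)%N; rewrite subnKC // => ->.
  rewrite index_cat mem_rcons inE eqxx /= -cats1 index_cat mem_rev.
  case: (next_siteP r1 (G k)) => /negbTE; rewrite -/v => -> _.
  by rewrite /= eqxx addn0 size_rev size_site_enum.
have phiG x k : [seq phi x v | v <- G k] = history p x k.
  elim: k => // k IHk; rewrite [LHS]/= IHk /phi stageG //.
have mphi : measurable_fun [set: measurableTypeR R] phi.
  apply: (@measurability _ _ (measurableTypeR R) (Cfg r n) setT phi (@cyl_on r n setT)) => //.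
  move=> _ [_ [v [i [_ ->]]] <-]; rewrite setTI.
  have H := measurable_history p0 p1 pS (stage v).+1 [set t | head ord0 t = i]; exact: H.
have [mu muE] := pushforward_probability Q mphi; exists mu.
have muG k a : mu (cyl (G k) a) = (chain_wt (G k) a)%:E.
  rewrite -pG -(QE k) ?muE ?size_map ?size_site_enum //; congr (Q _).
  apply/seteqP; split=> x /=; rewrite -phiG => H.
    by apply/eq_in_map.
  exact/eq_in_map.
(* [U] collects the enumerated sites outside [s]. The factor of a new site [v] of [s] involves only
   [v] and [pa v], neither of them in [U], so it comes out of the sum over [U]. *)
have key k s a : grow s -> mu (cyl [seq v <- G k | v \in s] a) =
    (chain_wt [seq v <- G k | v \in s] a)%:E.
  move=> gs; elim: k => [|k IHk].
    by rewrite /= cyl_nil probability_setT /chain_wt big_nil.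
  rewrite [G _]/= /=; case: ifP => // vs; set v := next_site _ _ in vs *.
  set t := [seq v <- G k | v \in s] in IHk *.
  pose U := [fset w in G k | w \notin s]%fset.
  have Ut w : w \in U -> w \notin t.
    by rewrite !inE mem_filter /= => /andP[_ /negbTE->].
  have Uvt w : w \in U -> w \notin v :: t.
    move=> wU; rewrite inE negb_or Ut // andbT; apply: contraTneq wU => ->.
    by rewrite !inE /= vs andbF.
  have vG : v \notin G k by have [] := next_siteP r1 (G k).
  have vU : v \notin U by rewrite !inE /= (negbTE vG).
  have Utmem : U ++ t =i G k.
    move=> w; rewrite mem_cat mem_filter !inE /=.
    by case: (w \in s); rewrite /= ?andbT ?andbF ?orbF.
  rewrite /chain_wt big_cons -/(chain_wt t a) mulrC EFinM -IHk.
  rewrite (prob_cyl_marginal _ _ Uvt) (prob_cyl_marginal _ _ Ut) muleC.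
  rewrite ge0_sume_distrr; last by [].
  apply: eq_bigr => xi _.
  rewrite (_ : cyl (U ++ v :: t) _ = cyl (G k.+1) (glue xi a)); last first.
    apply: eq_cyl => // w; rewrite -[G k.+1]/(v :: G k) mem_cat !in_cons -Utmem.
    by rewrite mem_cat orbCA.
  rewrite (_ : cyl (U ++ t) _ = cyl (G k) (glue xi a)); last exact: eq_cyl.
  rewrite !muG -EFinM; congr _%:E; rewrite {1}/chain_wt big_cons -/v; congr (_ * _).
  rewrite /step_wt glue_notin //; case: eqP => // /eqP v0; rewrite glue_notin //.
  by rewrite !inE (grow_pa gs vs v0) andbF.
move=> s a gs.
pose K := (\max_(v <- s) (word_code (val v)).+1)%N.
have sK : {subset s <= G K}.
  move=> v vs; have := leq_bigmax_seq (P := xpredT)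
    (F := fun v : site r => (word_code (val v)).+1) _ vs isT.
  rewrite -/K => vK; rewrite /G -(subnK vK); elim: (_ - _)%N => [|m IHm].
    exact: site_enum_cover.
  by rewrite addSn inE IHm orbT.
have pe : perm_eq [seq v <- G K | v \in s] s.
  apply: uniq_perm; rewrite ?filter_uniq ?grow_uniq ?grow_site_enum // => v.
  by rewrite mem_filter; case: (boolP (v \in s)) => // /sK ->.
rewrite -(eq_cyl (perm_mem pe) (fun _ _ => erefl)) key //.
by rewrite /chain_wt (perm_big _ pe).
Qed.

End Chain.

(** * Real-valued probabilities and scaled restrictions *)

Section RealProbability.
Variables (R : realType) (r n : nat) (mu : probability (Cfg r n) R).
Implicit Types (A B X : set (Cfg r n)).

Definition pr A : R := fine (mu A).

Lemma prE A : measurable A -> mu A = (pr A)%:E.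
Proof. by move=> mA; rewrite fineK // fin_num_measure. Qed.

Lemma pr_ge0 A : 0 <= pr A.
Proof. exact: fine_ge0. Qed.

Lemma le_pr A B : measurable A -> measurable B -> A `<=` B -> pr A <= pr B.
Proof.
by move=> mA mB AB; rewrite -lee_fin -!prE //; apply: le_measure; rewrite ?inE.
Qed.

Lemma pr_marginal (U : {fset site r}) s b :
  (forall v, v \in U -> v \notin s) ->
  pr (cyl s b) = \sum_(xi : {ffun U -> 'I_n.+1}) pr (cyl (U ++ s) (glue xi b)).
Proof.
move=> Us; apply/EFin_inj; rewrite -prE; last exact: measurable_cyl.
rewrite (prob_cyl_marginal _ _ Us) -sumEFin; apply: eq_bigr => xi _.
by rewrite prE //; exact: measurable_cyl.
Qed.

(** A product such as [c * pr (A & X)], seen as a measure in [A], so that product identities extend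
    from cylinders by uniqueness of measures. *)
Definition scaled_restr (c : {nonneg R}) X (mX : measurable X) :
  {measure set (Cfg r n) -> \bar R} := mscale c (mrestr mu mX).

Lemma scaled_restrE (c : {nonneg R}) X (mX : measurable X) A :
  measurable A -> scaled_restr c mX A = (c%:num * pr (A `&` X))%:E.
Proof. by move=> mA; rewrite /= /mscale /= /mrestr prE //; exact: measurableI. Qed.

Lemma scaled_restr_cyl (c : {nonneg R}) X (mX : measurable X) V a :
  scaled_restr c mX (cyl V a) = (c%:num * pr (cyl V a `&` X))%:E.
Proof. by apply: scaled_restrE; exact: measurable_cyl. Qed.

End RealProbability.

(** * Chains are simple *)

Section ChainSimple.
Variables (R : realType) (r n : nat) (pi : 'I_n.+1 -> R) (P : 'I_n.+1 -> 'I_n.+1 -> R).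
Variable mu : probability (Cfg r n) R.
Implicit Types (a b : site r -> 'I_n.+1) (u v : site r) (s V : seq (site r)).
Hypothesis muE : forall s a, grow s -> mu (cyl s a) = (chain_wt pi P s a)%:E.

Definition mix (C : set (site r)) u (i : 'I_n.+1) a b : site r -> 'I_n.+1 :=
  fun v => if `[< C v >] then a v else if v == u then i else b v.

(* An edge of the tree leaving [C] ends at [u], so each factor ignores either
   [a] or [b]. *)
Lemma chain_wt_swap C u i s a b a' b' : component u C ->
  chain_wt pi P s (mix C u i a b) * chain_wt pi P s (mix C u i a' b') =
  chain_wt pi P s (mix C u i a b') * chain_wt pi P s (mix C u i a' b).
Proof.
move=> uC; rewrite /chain_wt -!big_split /=; apply: eq_bigr => v _.
have nCu : `[< C u >] = false.
  by apply/asboolP => /(component_neq uC); rewrite eqxx.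
rewrite /step_wt /mix; case: eqP => [vr|/eqP v0].
  by case: ifP => // _; case: eqP => // _; rewrite mulrC.
case: (eqVneq v u) => [->|vu].
  by rewrite nCu; case: ifP => // _; rewrite mulrC.
have CC : (pa v != u) -> `[< C (pa v) >] = `[< C v >].
  move=> pu; apply/asboolP/asboolP => Cx.
    exact: component_tadj uC Cx (tadj_pa v0) vu.
  by apply: component_tadj uC Cx _ pu; rewrite tadjC tadj_pa.
case: (eqVneq (pa v) u) CC => [->|pu] CC.
  by rewrite nCu; case: ifP => // _; rewrite mulrC.
by rewrite CC //; case: ifP => // _; rewrite mulrC.
Qed.

Let pr_grow s a : grow s -> pr mu (cyl s a) = chain_wt pi P s a.
Proof. by move=> gs; rewrite /pr muE. Qed.

Definition far_side (C : set (site r)) u : set (site r) := [set v | ~ C v /\ v != u].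

Notation at_site u i := [set phi : Cfg r n | phi u = i].

(** When all of [s] is fixed, the probability is the weight [f x y] of a mixed configuration. The
    other three probabilities are sums of [f] over one or both arguments, and [chain_wt_swap]
    matches the products term by term. The product form avoids dividing by a probability that may
    vanish. *)
Lemma cond_indep_cyl_full C u i s a b : component u C -> grow s -> u \in s ->
  let A := cyl [seq v <- s | `[< C v >]] a in
  let B := cyl [seq v <- s | `[< far_side C u v >]] b in
  pr mu (A `&` B `&` at_site u i) * pr mu (at_site u i) =
  pr mu (A `&` at_site u i) * pr mu (B `&` at_site u i).
Proof.
move=> uC gs us; set VC := [seq v <- s | _]; set VD := [seq v <- s | _].
move=> A B; pose f x y := chain_wt pi P s (mix C u i x y).
pose UC : {fset site r} := [fset v in VC]%fset.
pose UD : {fset site r} := [fset v in VD]%fset.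
have UCE v : (v \in UC) = (v \in VC) by rewrite inE.
have UDE v : (v \in UD) = (v \in VD) by rewrite inE.
have nCu : ~ C u by move/(component_neq uC); rewrite eqxx.
have VCE v : (v \in VC) = (v \in s) && `[< C v >] by rewrite mem_filter andbC.
have VDE v : (v \in VD) = [&& v \in s, ~~ `[< C v >] & v != u].
  rewrite mem_filter andbC; congr (_ && _); apply/asboolP/andP => -[H1 H2].
    by split=> //; apply/asboolPn.
  by split=> //; apply/asboolPn.
have mixC x y v : v \in VC -> mix C u i x y v = x v.
  by rewrite VCE /mix => /andP[_ ->].
have mixD x y v : v \in VD -> mix C u i x y v = y v.
  by rewrite VDE /mix => /and3P[_ /negbTE-> /negbTE->].
have mixu x y : mix C u i x y u = i.
  by rewrite /mix eqxx; case: asboolP.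
have uVC : u \notin VC by rewrite VCE; case: asboolP; rewrite ?andbF.
have uVD : u \notin VD by rewrite VDE eqxx !andbF.
have VCD v : v \in VC -> v \notin VD by rewrite VCE VDE => /andP[-> ->].
have cylu x y : at_site u i = cyl [:: u] (mix C u i x y).
  by rewrite cyl_coord; apply: eq_cyl => // v; rewrite inE => /eqP->.
have smem : VC ++ VD ++ [:: u] =i s.
  move=> v; rewrite !mem_cat VCE VDE inE.
  case: (eqVneq v u) => [->|vu]; first by rewrite us !orbT.
  by rewrite orbF andbT; case: (v \in s) => //=; case: `[< _ >].
have AE x y : cyl VC x = cyl VC (mix C u i x y).
  by apply: eq_cyl => // v vC; rewrite mixC.
have BE x y : cyl VD y = cyl VD (mix C u i x y).
  by apply: eq_cyl => // v vD; rewrite mixD.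
have prA x : pr mu (cyl VC x `&` at_site u i) =
    \sum_(xi : {ffun UD -> 'I_n.+1}) f x (glue xi b).
  rewrite (AE x b) (cylu x b) -cyl_cat (@pr_marginal _ _ _ _ UD).
    apply: eq_bigr => xi _; rewrite /f -pr_grow //; congr (pr mu _); apply: eq_cyl.
      by move=> v; rewrite -smem !mem_cat UDE orbCA.
    move=> v; rewrite !mem_cat mem_seq1; case: (boolP (v \in UD)) => [vU _|vD /= vCu].
      by rewrite mixD -?UDE // -[v]/(val [` vU]%fset) !glue_in.
    by rewrite glue_notin //; rewrite /mix glue_notin.
  move=> v; rewrite UDE mem_cat inE => vD; rewrite negb_or.
  rewrite (contraL (@VCD v)) //=; by apply: contraNneq uVD => <-.
have prAB x y : pr mu (cyl VC x `&` cyl VD y `&` at_site u i) = f x y.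
  rewrite (AE x y) (BE x y) (cylu x y) -setIA -!cyl_cat /f -pr_grow //.
  by congr (pr mu _); apply: eq_cyl.
have prB : pr mu (B `&` at_site u i) = \sum_(zt : {ffun UC -> 'I_n.+1}) f (glue zt a) b.
  rewrite /B (BE a b) (cylu a b) -cyl_cat (@pr_marginal _ _ _ _ UC).
    apply: eq_bigr => zt _; rewrite /f -pr_grow //; congr (pr mu _); apply: eq_cyl.
      by move=> v; rewrite -smem !mem_cat UCE.
    move=> v; rewrite !mem_cat mem_seq1; case: (boolP (v \in UC)) => [vU _|vC /= vDu].
      by rewrite mixC -?UCE // -[v]/(val [` vU]%fset) !glue_in.
    by rewrite glue_notin //; rewrite /mix glue_notin.
  move=> v; rewrite UCE mem_cat inE => vC; rewrite negb_or VCD //=.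
  by apply: contraNneq uVC => <-.
have prE : pr mu (at_site u i) = \sum_(zt : {ffun UC -> 'I_n.+1})
    \sum_(xi : {ffun UD -> 'I_n.+1}) f (glue zt a) (glue xi b).
  rewrite (cylu a b) (@pr_marginal _ _ _ _ UC).
    apply: eq_bigr => zt _; rewrite -prA (cylu a b); congr (pr mu _).
    rewrite cyl_cat; congr (_ `&` _).
      apply: eq_cyl => v; first exact: UCE.
      case: (boolP (v \in UC)) => [vU _|/negP//].
      by rewrite -[v]/(val [` vU]%fset) !glue_in.
    by apply: eq_cyl => // v; rewrite mem_seq1 => /eqP->; rewrite glue_notin // UCE.
  by move=> v; rewrite UCE inE => vC; apply: contraNneq uVC => <-.
rewrite prAB prA prB prE big_distrlr mulr_sumr exchange_big /=.
apply: eq_bigr => xi _; rewrite mulr_sumr; apply: eq_bigr => zt _.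
exact: chain_wt_swap.
Qed.

(** The identity passes from cylinders to general events one side at a time: first to [A] with a
    cylinder as second event, then to [B] with [A] fixed. *)
Lemma cond_indep C u i (A B : set (Cfg r n)) : component u C ->
  <<s @cyl_on r n C >> A -> <<s @cyl_on r n (far_side C u) >> B ->
  pr mu (A `&` B `&` at_site u i) * pr mu (at_site u i) =
  pr mu (A `&` at_site u i) * pr mu (B `&` at_site u i).
Proof.
move=> uC sA sB.
have mE := measurable_coord u i : measurable (at_site u i : set (Cfg r n)).
pose c X : {nonneg R} := NngNum (pr_ge0 mu X).
have fin (e : {nonneg R}) X (mX : measurable X) :
    (scaled_restr mu e mX setT < +oo)%E.
  by rewrite scaled_restrE ?ltry.
have eqE (x y : R) : (x%:E = y%:E) -> x = y by case.
have step V V' b : (forall v, v \in V -> C v) -> (forall v, v \in V' -> far_side C u v) ->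
    exists V2, [/\ {subset V <= V2}, forall v, v \in V2 -> C v &
    forall a, pr mu (cyl V2 a `&` cyl V' b `&` at_site u i) * pr mu (at_site u i) =
      pr mu (cyl V2 a `&` at_site u i) * pr mu (cyl V' b `&` at_site u i)].
  move=> VC VD; have [s gs ss] := grow_cover (u :: V ++ V').
  exists [seq v <- s | `[< C v >]]; split=> [v vV|v|{}a].
  - by rewrite mem_filter ss ?inE ?mem_cat ?vV ?orbT // andbT; apply/asboolP/VC.
  - by rewrite mem_filter => /andP[/asboolP].
  set VC2 := [seq v <- s | _].
  have mAE : measurable (cyl VC2 a `&` at_site u i).
    by apply: measurableI => //; exact: measurable_cyl.
  have := @cyl_measure_sub R r n (scaled_restr mu (c (at_site u i)) mAE)
    (scaled_restr mu (c (cyl VC2 a `&` at_site u i)) mE)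
    V' [seq v <- s | `[< far_side C u v >]] _ _ b.
  rewrite !scaled_restr_cyl /= => H.
  rewrite [LHS]mulrC [cyl VC2 a `&` _]setIC -setIA; apply/eqE/H => [v vV|b'].
    rewrite mem_filter ss ?inE ?mem_cat ?vV ?orbT // andbT.
    by apply/asboolP/VD.
  rewrite !scaled_restr_cyl /=; congr _%:E.
  rewrite mulrC setIA [cyl _ b' `&` cyl _ a]setIC.
  by apply: cond_indep_cyl_full => //; apply: ss; rewrite inE eqxx.
have stepA V' b : (forall v, v \in V' -> far_side C u v) ->
    pr mu (A `&` cyl V' b `&` at_site u i) * pr mu (at_site u i) =
    pr mu (A `&` at_site u i) * pr mu (cyl V' b `&` at_site u i).
  move=> VD; have mBE : measurable (cyl V' b `&` at_site u i).
    by apply: measurableI => //; exact: measurable_cyl.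
  have := @cyl_measure_eq R r n C (scaled_restr mu (c (at_site u i)) mBE)
    (scaled_restr mu (c (cyl V' b `&` at_site u i)) mE) (fin _ _ _) _ A sA.
  rewrite !(scaled_restrE _ _ _ (cyl_sigma_measurable sA)) /= => H.
  rewrite [LHS]mulrC [RHS]mulrC -setIA; apply/eqE/H => V VC.
  have [V2 [VV VC2 ag]] := step V V' b VC VD; exists V2; split=> // a.
  rewrite !scaled_restr_cyl /=; congr _%:E.
  by rewrite mulrC setIA ag mulrC.
have mAE : measurable (A `&` at_site u i).
  by apply: measurableI => //; exact: cyl_sigma_measurable sA.
have := @cyl_measure_eq R r n (far_side C u) (scaled_restr mu (c (at_site u i)) mAE)
    (scaled_restr mu (c (A `&` at_site u i)) mE) (fin _ _ _) _ B sB.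
rewrite !(scaled_restrE _ _ _ (cyl_sigma_measurable sB)) /= => H.
rewrite [LHS]mulrC [A `&` B]setIC -setIA; apply/eqE/H => V VD.
exists V; split=> // b; rewrite !scaled_restr_cyl /=; congr _%:E.
by rewrite mulrC setIA [cyl V b `&` A]setIC stepA.
Qed.

(** Components are split off one by one. Distinct components are disjoint and avoid [u], so the
    intersection of the remaining events lives on the far side of the current one. *)
Lemma chain_simple : is_simple mu.
Proof.
move=> u i k C B CI uC sB E0.
have mE := measurable_coord u i : measurable (at_site u i : set (Cfg r n)).
have {}E0 : 0 < pr mu (at_site u i) by move: E0; rewrite prE // lte_fin.
rewrite /cprob -!/(pr mu _); under eq_bigr do rewrite -!/(pr mu _).
have E1 : pr mu (at_site u i) != 0 by rewrite gt_eqF.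
have key (s : seq 'I_k) : uniq s ->
    pr mu ((\big[setI/setT]_(j <- s) B j) `&` at_site u i) / pr mu (at_site u i) =
    \prod_(j <- s) (pr mu (B j `&` at_site u i) / pr mu (at_site u i)).
  elim: s => [_|j s IHs /= /andP[js us]]; first by rewrite !big_nil setTI divff.
  rewrite !big_cons -IHs //.
  have sF : <<s @cyl_on r n (far_side (C j) u) >> (\big[setI/setT]_(l <- s) B l).
    rewrite big_seq.
    apply: (big_ind (fun X => <<s @cyl_on r n (far_side (C j) u) >> X)).
    - exact: (@measurableT _ (g_sigma_algebraType (cyl_on (far_side (C j) u)))).
    - move=> X Y sX sY.
      exact: (@measurableI _ (g_sigma_algebraType (@cyl_on r n (far_side (C j) u)))).
    - move=> l ls; apply: sub_cyl_sigma (sB l) => v Clv; split.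
        move=> Cjv; move: js; rewrite (CI _ _ (component_eq (uC j) (uC l) Cjv Clv)) ls //.
      exact: component_neq (uC l) Clv.
  have := cond_indep i (uC j) (sB j) sF.
  by move/(canRL (mulfK E1)) => ->; field.
rewrite -(key _ (index_enum_uniq _)) -bigcap_seq; congr (pr mu (_ `&` _) / _).
by apply/seteqP; split=> phi Bphi j _; apply: Bphi => //=; exact: mem_index_enum.
Qed.

End ChainSimple.

(** * Simple measures with given site and edge laws are chains *)

Section SimpleChain.
Variables (R : realType) (r n : nat).
Implicit Types (a b : site r -> 'I_n.+1) (u v w : site r) (s : seq (site r)).
Notation at_site u i := [set phi : Cfg r n | phi u = i].

Lemma grow_root s : grow s -> s != [::] -> root r \in s.
Proof.
elim: s => //= v s IHs /and3P[gs _ vs] _; rewrite inE.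
case: s IHs gs vs => [_ _|w s IHs gs _]; last by rewrite IHs ?orbT.
by rewrite orbF => /eqP->; rewrite eqxx.
Qed.

Lemma dir_pa v : v != root r -> dir (pa v) v = last ord0 (val v).
Proof.
move=> v0; have vE : nbr (pa v) (last ord0 (val v)) = v.
  by rewrite /nbr extendable_pa // ext_pa.
by rewrite -{2}vE dir_nbr.
Qed.

Lemma branch_pa v w : v != root r -> w != pa v -> dir (pa v) w = dir (pa v) v ->
  prefix_of v w.
Proof.
move=> v0 wu wv; have := dir_branch wu; rewrite wv dir_pa // /branch /=.
have -> : nbr (pa v) (last ord0 (val v)) = v by rewrite /nbr extendable_pa // ext_pa.
apply: (@avoid_conn_ind _ (pa v) (prefix_of v)); first exact: prefix_of_refl.
move=> y z yu zu; rewrite tadjE => /orP[] /andP[x0 /eqP xE] vy.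
  case: (eqVneq z v) => [->|zv]; first exact: prefix_of_refl.
  by rewrite (prefix_of_child x0 xE zv).
have yv : y != v by apply: contraNneq zu => yv; rewrite xE yv.
by rewrite -(prefix_of_child x0 xE yv).
Qed.

Variables (nu : probability (Cfg r n) R) (pi : 'I_n.+1 -> R) (M : 'I_n.+1 -> 'I_n.+1 -> R).
Hypothesis nuS : is_simple nu.
Hypothesis nuV : forall v i, pr nu (at_site v i) = pi i.
Hypothesis nuE : forall v i j, v != root r ->
  pr nu (at_site (pa v) i `&` at_site v j) = M i j.

(* The site [v] added last is alone in its branch at [pa v], so conditional
   independence at [pa v] splits off a factor for the edge to [v]. *)
Lemma simple_chain s a : grow s ->
  nu (cyl s a) = (chain_wt pi (fun i j => M i j / pi i) s a)%:E.
Proof.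
have mE u i : measurable (at_site u i : set (Cfg r n)) by exact: measurable_coord.
move=> gs; rewrite prE; last exact: measurable_cyl; congr _%:E.
elim: s gs => [_|v s IHs gvs].
  by rewrite cyl_nil /pr probability_setT /chain_wt big_nil.
have gs : grow s by case/and3P: gvs.
rewrite /chain_wt big_cons -/(chain_wt pi _ s a) -IHs // /step_wt.
case: (eqVneq v (root r)) => [v0|v0].
  have -> : s = [::].
    apply/eqP/negPn/negP => /(grow_root gs); case/and3P: gvs => _.
    by rewrite v0 => /negbTE->.
  rewrite cyl_nil /pr probability_setT mulr1 cyl_cons cyl_nil setIT -/(pr nu _).
  by rewrite nuV v0.
set u := pa v; have us : u \in s.
  by case/and3P: gvs => _ _; rewrite (negbTE v0).
have mc V : measurable (cyl V a) by exact: measurable_cyl.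
have vE (V : seq (site r)) : u \in V -> cyl V a `<=` at_site u (a u).
  by move=> uV phi; apply.
(* If the parent has its value with probability 0, both sides vanish: the cylinder is null, and the
   quotient by 0 is 0. *)
case: (eqVneq (pi (a u)) 0) => [pu0|pu].
  rewrite pu0 invr0 mulr0 mul0r; apply/eqP; rewrite eq_le pr_ge0 andbT.
  rewrite -pu0 -(nuV u); apply: le_pr => //.
  by apply: vE; rewrite inE us orbT.
have pu0 : (0 < nu (at_site u (a u)))%E.
  by rewrite prE // lte_fin lt_neqAle pr_ge0 nuV eq_sym pu.
pose B V c := cyl [seq w <- V | (w != u) && (dir u w == c)] a.
have simpleB V : u \in V -> pr nu (cyl V a) / pi (a u) =
    \prod_(c < r.+1) (pr nu (B V c `&` at_site u (a u)) / pi (a u)).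
  move=> uV; have := @nuS u (a u) r.+1 (branch u) (B V) (@branch_inj _ u)
    (@branch_component _ u) _ pu0.
  rewrite /cprob -!/(pr nu _) nuV; under eq_bigr do rewrite -/(pr nu _).
  move=> <-.
    congr (pr nu _ / _); apply/seteqP; split=> phi.
      move=> pa; split; last exact: pa.
      by move=> c _ w; rewrite mem_filter => /andP[_]; exact: pa.
    case=> pB pE w wV; case: (eqVneq w u) => [->//|wu].
    by apply: (pB (dir u w) I); rewrite mem_filter wV wu eqxx.
  move=> c; apply: cyl_sigma => w; rewrite mem_filter => /andP[/andP[wu /eqP <-] _].
  exact: dir_branch.
have vu : v != u by rewrite eq_sym; exact/tadj_irr/tadj_pa.
(* The product formulas for [v :: s] and [s] differ only in the factor for the direction of [v]. For
   [s] this branch is empty by [grow_leaf], so the factor is 1; for [v :: s] it is the step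
   probability. *)
have := simpleB (v :: s); rewrite inE us orbT => /(_ isT).
rewrite (bigD1 (dir u v)) //= => sv.
have := simpleB s us; rewrite (bigD1 (dir u v)) //= => ss.
have Bs : B s (dir u v) = setT.
  rewrite /B (_ : [seq w <- s | _] = [::]) ?cyl_nil //.
  apply/eqP; rewrite -size_eq0 size_filter -leqn0 leqNgt -has_count.
  apply/hasPn => w ws; apply/negP => /andP[wu /eqP wv].
  by have := grow_leaf gvs ws; rewrite (branch_pa v0 wu wv).
have Bvs : B (v :: s) (dir u v) = at_site v (a v).
  rewrite /B /= vu eqxx /= cyl_cons -/(B s (dir u v)) Bs setIT //.
move: ss; rewrite Bs setTI nuV divff // mul1r => ss.
move: sv; rewrite Bvs setIC nuE // => /(canRL (divfK pu)) ->.
rewrite mulrAC -mulrA; congr (_ * _).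
rewrite (eq_bigr (fun c => pr nu (B s c `&` at_site u (a u)) / pi (a u))) => [|c cv].
  by rewrite -ss mulrC divfK.
by rewrite /B /= vu eq_sym (negbTE cv).
Qed.
End SimpleChain.

(** * Reversible chains are invariant *)

Section ChainInvariant.
Variables (R : realType) (r n : nat) (pi : 'I_n.+1 -> R) (M : 'I_n.+1 -> 'I_n.+1 -> R).
Hypotheses (pi0 : forall i, 0 < pi i) (piE : forall i, pi i = \sum_j M i j).
Hypothesis MC : forall i j, M i j = M j i.
Variable mu : probability (Cfg r n) R.
Notation P := (fun i j => M i j / pi i).
Hypothesis muE : forall s (a : site r -> 'I_n.+1), grow s ->
  mu (cyl s a) = (chain_wt pi P s a)%:E.
Notation at_site u i := [set phi : Cfg r n | phi u = i].
Implicit Types (u v w : site r) (s : seq (site r)).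

Lemma chain_measure_unique (m1 m2 : probability (Cfg r n) R) :
  (forall s a, grow s -> m1 (cyl s a) = m2 (cyl s a)) ->
  forall A : set (Cfg r n), measurable A -> m1 A = m2 A.
Proof.
move=> mm A mA; apply: (@cyl_measure_eq R r n setT m1 m2) => //.
  by rewrite [X in (X < _)%E](_ : _ = 1%E) ?ltry //; exact: probability_setT.
move=> V _; have [s gs Vs] := grow_cover V; exists s; split=> // a; exact: mm.
Qed.

Lemma pr_site_split (m : probability (Cfg r n) R) u (A : set (Cfg r n)) :
  measurable A -> pr m A = \sum_i pr m (at_site u i `&` A).
Proof.
move=> mA; apply/EFin_inj; rewrite -prE // -sumEFin.
have mEA i : measurable (at_site u i `&` A).
  by apply: measurableI => //; exact: measurable_coord.
rewrite [in LHS](_ : A = \big[setU/set0]_(i < n.+1) (at_site u i `&` A)).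
  rewrite measure_bigsetU_ord //; first by apply: eq_bigr => i _; exact: prE.
  by move=> i j _ _ [phi [[pi' _] [pj _]]]; rewrite -pi' -pj.
rewrite -bigcup_seq; apply/seteqP; split=> [phi Aphi|phi [i _ []] //].
by exists (phi u) => //=; exact: mem_index_enum.
Qed.

Lemma grow_filter (p : pred (site r)) s : grow s ->
  (forall w, w != root r -> p w -> p (pa w)) -> grow [seq w <- s | p w].
Proof.
move=> + pp; elim: s => //= v s IHs /and3P[/IHs gs vs ps].
case: ifP => //= pv; rewrite gs !mem_filter (negbTE vs) andbF /=.
by case: eqVneq ps => //= v0 ->; rewrite pp.
Qed.

(** Deleting [v] and all its descendants from a grown list keeps it closed under parents. *)
Lemma grow_before v : v != root r -> exists2 s, grow (v :: s) & pa v \in s.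
Proof.
move=> v0; have [t gt /(_ v (mem_head _ _)) vt] := grow_cover [:: v].
have nv : ~~ prefix_of v (pa v).
  apply/negP => /eqP /(congr1 size); rewrite size_take (size_site v0).
  by case: ltnP => [/ltnW|_ /eqP]; rewrite ?ltnn // eqn_leq ltnn andbF.
pose s := [seq w <- t | ~~ prefix_of v w].
have ps : pa v \in s by rewrite mem_filter nv grow_pa.
exists s => //=; rewrite ps orbT andbT mem_filter prefix_of_refl andbT.
apply: grow_filter => // w w0; apply: contra => vw; have [->|wv] := eqVneq w v.
  exact: prefix_of_refl.
by rewrite (prefix_of_child w0 erefl wv).
Qed.

Let pr_grow s (a : site r -> 'I_n.+1) : grow s -> pr mu (cyl s a) = chain_wt pi P s a.
Proof. by move=> gs; rewrite /pr muE. Qed.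

Lemma chain_edge_step v i j : v != root r ->
  pr mu (at_site (pa v) i `&` at_site v j) = pr mu (at_site (pa v) i) * P i j.
Proof.
move=> v0; have [s gvs us] := grow_before v0; set u := pa v in us *.
have [gs vs] : grow s /\ v \notin s by case/and3P: gvs.
have vu : v != u by apply: contraNneq vs => ->.
pose b w := if w == u then i else j.
have bu : b u = i by rewrite /b eqxx.
have bv : b v = j by rewrite /b (negbTE vu).
have uE : at_site u i = cyl [:: u] b.
  by rewrite cyl_coord; apply: eq_cyl => // w; rewrite mem_seq1 => /eqP->.
have uvE : at_site u i `&` at_site v j = cyl [:: v; u] b.
  by rewrite cyl_cons -uE bv setIC.
pose U := [fset w in s | w != u]%fset.
have UE w : (w \in U) = (w \in s) && (w != u) by rewrite !inE.
have uU : u \notin U by rewrite UE eqxx andbF.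
have vU : v \notin U by rewrite UE (negbTE vs).
have Us : U ++ [:: u] =i s.
  move=> w; rewrite mem_cat mem_seq1 UE; case: (eqVneq w u) => [->|_].
    by rewrite us orbT.
  by rewrite andbT orbF.
rewrite uvE uE (@pr_marginal _ _ _ _ U [:: v; u]); last first.
  by move=> w wU; rewrite !inE negb_or; apply/andP; split;
    apply: contraTneq wU => ->.
rewrite (@pr_marginal _ _ _ _ U [:: u]); last first.
  by move=> w wU; rewrite mem_seq1; apply: contraTneq wU => ->.
rewrite mulr_suml; apply: eq_bigr => xi _.
rewrite (@eq_cyl _ _ (U ++ [:: v; u]) (v :: s) _ (glue xi b)) //; last first.
  by move=> w; rewrite mem_cat in_cons orbCA -mem_cat Us.
rewrite (@eq_cyl _ _ (U ++ [:: u]) s _ (glue xi b)) // !pr_grow //.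
rewrite /chain_wt big_cons mulrC; congr (_ * _); rewrite /step_wt (negbTE v0).
by rewrite -/u !glue_notin // bu bv.
Qed.

(** Symmetry of [M] makes [pi] its marginal in both coordinates, so [pi] is stationary along every
    edge. *)
Lemma chain_site v i : pr mu (at_site v i) = pi i.
Proof.
elim/site_ind: v i => [|v v0 IHv] i.
  have -> : at_site (root r) i = cyl [:: root r] (fun=> i) by rewrite cyl_coord.
  by rewrite pr_grow /= ?eqxx // /chain_wt big_seq1 /step_wt eqxx.
rewrite (@pr_site_split _ (pa v)); last exact: measurable_coord.
rewrite piE; apply: eq_bigr => j _; rewrite chain_edge_step // IHv.
by rewrite mulrC divfK ?gt_eqF // MC.
Qed.

Lemma chain_edge u v i j : tadj u v ->
  pr mu (at_site u i `&` at_site v j) = M i j.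
Proof.
rewrite tadjE => /orP[] /andP[x0 /eqP ->].
  by rewrite chain_edge_step // chain_site mulrC divfK // gt_eqF.
by rewrite setIC chain_edge_step // chain_site mulrC divfK ?gt_eqF // MC.
Qed.

Lemma comp_aut_measurable (g : site r -> site r) (D : set (site r)) :
  measurable_fun (setT : set (g_sigma_algebraType (@cyl_on r n (g @` D))))
    (fun phi : g_sigma_algebraType (@cyl_on r n (g @` D)) =>
      (phi \o g : g_sigma_algebraType (@cyl_on r n D))).
Proof.
apply: (@measurability _ _ _ (g_sigma_algebraType (@cyl_on r n D)) setT _ (@cyl_on r n D)) => //.
move=> _ [_ [v [i [Dv ->]]] <-]; rewrite setTI.
by apply: sub_sigma_algebra; exists (g v), i; split=> //; exists v.
Qed.

(** An automorphism may move the root, so weights cannot be compared factor by factor. Instead the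
    image measure is shown to be simple with the same site and edge laws, the latter because
    [chain_edge] holds for both orientations, and [simple_chain] identifies it. *)
Lemma chain_invariant : is_invariant mu.
Proof.
move=> g ga A mA.
have mg : measurable_fun [set: Cfg r n] (fun phi : Cfg r n => (phi \o g : Cfg r n)).
  apply: (@measurability _ _ (Cfg r n) (Cfg r n) setT _ (@cyl_on r n setT)) => //.
  move=> _ [_ [v [i [Dv ->]]] <-]; rewrite setTI.
  exact: (measurable_coord (g v) i).
have [nu nuE] := pushforward_probability mu mg.
rewrite -[LHS]nuE; apply: chain_measure_unique A mA => s a gs; rewrite muE //.
apply: simple_chain gs.
- move=> u i k C B CI uC sB E0.
  have gI : injective g by case: ga => /bij_inj.
  have := chain_simple muE (u := g u) (i := i) (C := fun j => g @` (C j))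
    (B := fun j => [set phi : Cfg r n | B j (phi \o g)]).
  rewrite /cprob => H; rewrite !nuE in E0 *.
  transitivity (fine (mu (\bigcap_j [set phi : Cfg r n | B j (phi \o g)] `&` at_site (g u) i))
    / fine (mu (at_site (g u) i))).
    by congr (fine (mu _) / _).
  rewrite H //.
  + by apply: eq_bigr => j _; rewrite !nuE.
  + move=> j l Cjl; apply: CI; apply/seteqP; split=> v Cv.
      have : (g @` C l) (g v) by rewrite -Cjl; exists v.
      by case=> w Cw /gI <-.
    have : (g @` C j) (g v) by rewrite Cjl; exists v.
    by case=> w Cw /gI <-.
  + by move=> j; exact: component_aut.
  + move=> j; have := @comp_aut_measurable g (C j) measurableT _ (sB j).
    by rewrite setTI.
- by move=> v i; rewrite /pr nuE; exact: (chain_site (g v) i).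
- move=> v i j v0; rewrite /pr nuE; apply: (chain_edge (u := g (pa v)) (v := g v)).
  by case: ga => _ ->; exact: tadj_pa.
Qed.

End ChainInvariant.

(** * The Gibbs property *)

Section GibbsWeights.
Variables (R : realType) (r n : nat) (h : rel 'I_n.+1).
Variables (w lam : 'I_n.+1 -> R).
Hypotheses (hS : symmetric h) (w0 : forall i, 0 < w i) (l0 : forall i, 0 < lam i).
Hypothesis z0 : forall i, 0 < nsum h w i.
Hypothesis wE : forall i, w i = lam i * nsum h w i ^+ r.
Implicit Types (a b : site r -> 'I_n.+1) (u v : site r) (s : seq (site r)).

Definition edge_total : R := \sum_i w i * nsum h w i.
Definition edge_law i j : R := if h i j then w i * w j / edge_total else 0.
Definition site_law i : R := w i * nsum h w i / edge_total.

Lemma edge_total_gt0 : 0 < edge_total.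
Proof.
rewrite /edge_total big_ord_recl; apply: ltr_pwDl; first exact: mulr_gt0.
by apply: sumr_ge0 => i _; rewrite mulr_ge0 // ltW.
Qed.

Lemma site_law_gt0 i : 0 < site_law i.
Proof. by rewrite divr_gt0 ?edge_total_gt0 ?mulr_gt0. Qed.

Lemma site_law_sum : \sum_i site_law i = 1.
Proof. by rewrite -mulr_suml divff // gt_eqF // edge_total_gt0. Qed.

Lemma site_lawE i : site_law i = \sum_j edge_law i j.
Proof.
rewrite /site_law /nsum mulr_sumr mulr_suml big_mkcond; apply: eq_bigr => j _.
by rewrite /edge_law; case: ifP.
Qed.

Lemma edge_lawC i j : edge_law i j = edge_law j i.
Proof. by rewrite /edge_law hS; case: ifP => // _; rewrite [w i * _]mulrC. Qed.

Lemma edge_law_ge0 i j : 0 <= edge_law i j.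
Proof.
rewrite /edge_law; case: ifP => // _.
by rewrite divr_ge0 ?mulr_ge0 ?ltW ?edge_total_gt0.
Qed.

Lemma step_lawE i j :
  edge_law i j / site_law i = (h i j)%:R * (w j / nsum h w i).
Proof.
rewrite /edge_law; case: ifP => _; last by rewrite !mul0r.
rewrite mul1r /site_law; field.
by rewrite !gt_eqF ?edge_total_gt0.
Qed.

Definition children s u := [seq v <- s | (v != root r) && (pa v == u)].

(* All factors of [chain_wt] that depend on the value [x] at [u], except the
   hard constraints: the denominators of the steps to the children of [u] make
   this [lam x] once all neighbours of [u] are in [s]. *)
Definition site_wt s u x : R :=
  w x * (if u == root r then nsum h w x / edge_total else 1) *
  \prod_(v <- children s u) (nsum h w x)^-1.

Definition hom_list s a := all (fun v => (v == root r) || h (a (pa v)) (a v)) s.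

Lemma prodb_all (T : Type) (p : pred T) (t : seq T) :
  \prod_(v <- t) (p v)%:R = (all p t)%:R :> R.
Proof.
elim: t => [|v t IHt]; first by rewrite big_nil.
by rewrite big_cons IHt /= -natrM mulnb.
Qed.

(** The denominator of the step into [v] depends on the value at [pa v]; exchanging the products
    assigns it to the parent. *)
Lemma chain_wt_sites s a : grow s ->
  chain_wt site_law (fun i j => edge_law i j / site_law i) s a =
  (\prod_(u <- s) site_wt s u (a u)) * (hom_list s a)%:R.
Proof.
move=> gs; rewrite -prodb_all /site_wt !big_split /=.
have -> : \prod_(u <- s) \prod_(v <- children s u) (nsum h w (a u))^-1 =
          \prod_(v <- s) (if v == root r then 1 else (nsum h w (a (pa v)))^-1).
  under eq_bigr do rewrite big_filter big_mkcond.
  rewrite exchange_big /= !big_seq; apply: eq_bigr => v vs.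
  case: eqVneq => v0 /=; first by rewrite big1.
  rewrite -big_mkcond /= (eq_bigl (pred1 (pa v))) => [|u]; last by rewrite /= eq_sym.
  by rewrite -[LHS]big_filter filter_pred1_uniq ?grow_uniq ?grow_pa // big_seq1.
rewrite -!big_split /=; apply: eq_bigr => v _; rewrite /step_wt.
case: eqVneq => _ /=; first by rewrite /site_law !mulr1 mulrA.
by rewrite step_lawE mulr1 mulrC.
Qed.

(** Away from the root exactly one letter leads back to the parent. *)
Lemma count_extendable u :
  count (extendable u) (enum 'I_r.+1) = (r + (u == root r))%N.
Proof.
case: eqVneq => [->|u0].
  by rewrite (eq_count (a2 := predT)) // count_predT size_enum_ord addn1.
have := count_predC (pred1 (last ord0 (val u))) (enum 'I_r.+1).
rewrite size_enum_ord count_uniq_mem ?enum_uniq // mem_enum add1n addn0 => -[E].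
rewrite -[RHS]E; apply: eq_count => a /=.
rewrite /extendable reducedw_rcons (valP u) /= [in RHS]eq_sym.
by case: eqP => // uE; case/eqP: u0; exact: val_inj.
Qed.

Lemma size_children s u : grow s -> (forall v, tadj u v -> v \in s) ->
  size (children s u) = (r + (u == root r))%N.
Proof.
move=> gs us; rewrite -count_extendable -size_filter -(size_map (ext u)).
apply: perm_size; apply: uniq_perm.
- by rewrite filter_uniq // grow_uniq.
- rewrite map_inj_in_uniq => [|a b]; first by rewrite filter_uniq // enum_uniq.
  rewrite !mem_filter => /andP[ea _] /andP[eb _] ab.
  by have := congr1 val ab; rewrite !val_ext // => /rcons_inj[].
move=> v; rewrite mem_filter; apply/andP/mapP => [[/andP[v0 /eqP pv] _]|[a]].
  exists (last ord0 (val v)); last by rewrite -pv ext_pa.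
  by rewrite mem_filter -pv extendable_pa // mem_enum.
rewrite mem_filter => /andP[ea _] ->; rewrite ext_neq_root // pa_ext // eqxx.
by split=> //; apply: us; rewrite tadjE ext_neq_root // pa_ext // eqxx.
Qed.

(** The weight equation enters here: the denominators from [r] children cancel [nsum h w x ^+ r].
    The root has one child more, which its initial law compensates. *)
Lemma site_wt_inner s u x : grow s -> (forall v, tadj u v -> v \in s) ->
  site_wt s u x = lam x * (if u == root r then edge_total^-1 else 1).
Proof.
move=> gs us; rewrite /site_wt big_const_seq count_predT size_children // iter_mulr_1 wE.
have zn : nsum h w x != 0 by rewrite gt_eqF.
case: eqP => _; last by rewrite addn0 mulr1 exprVn mulfK ?expf_neq0 // mulr1.
rewrite addn1 exprS exprVn; field.
by rewrite zn expf_neq0 // gt_eqF // edge_total_gt0.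
Qed.

(** An edge with an end in [U] lies within [Uplus U]; the remaining constraints do not involve
    values on [U]. *)
Lemma hom_on_glue (U : {fset site r}) s a : grow s -> (forall v, Uplus U v -> v \in s) ->
  hom_list s a = `[< hom_on h U a >] &&
    all (fun v => [|| v == root r, v \in U, pa v \in U | h (a (pa v)) (a v)]) s.
Proof.
move=> gs Us; apply/allP/andP => [ha|[/asboolP ha /allP hb] v vs].
  split; last first.
    by apply/allP => v /ha /orP[]->; rewrite ?orbT.
  apply/asboolP => u v Uu Uv; rewrite tadjE => /orP[] /andP[x0 /eqP ->].
    by have := ha v (Us v Uv); rewrite (negbTE x0).
  by rewrite hS; have := ha u (Us u Uu); rewrite (negbTE x0).
have := hb v vs; case: eqVneq => //= v0.
have hpv : tadj (pa v) v by exact: tadj_pa.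
have inU x : x \in U -> Uplus U x by move=> xU; left.
have nbU x y : x \in U -> tadj x y -> Uplus U y.
  move=> xU xy; case: (boolP (y \in U)) => yU; first by left.
  by right; split=> //; exists x.
case/or3P => // [vU|pU].
  by apply: ha => //; [apply: nbU vU _; rewrite tadjC|exact: inU].
by apply: ha => //; [exact: inU|exact: nbU pU _].
Qed.

Lemma lam_wt_list (U : {fset site r}) s a : uniq s ->
  (forall v, Uplus U v -> v \in s) ->
  lam_wt h lam U a = (`[< hom_on h U a >])%:R *
    ((\prod_(v <- s | v \in U) lam (a v)) *
     \prod_(v <- s | (v \notin U) && `[< Uplus U v >]) lam (a v)).
Proof.
move=> us Us; rewrite /lam_wt; congr (_ * _); first by case: asboolP.
pose t := [seq v <- s | `[< Uplus U v >]].
have tE : Uplus U = [set` t].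
  apply/seteqP; split=> v /=; rewrite mem_filter.
    by move=> Uv; rewrite Us // andbT; apply/asboolP.
  by case/andP => /asboolP.
rewrite [in LHS]tE -fsbig_seq ?filter_uniq // big_filter (bigID (fun v => v \in U)) /=.
congr (_ * _); apply: eq_bigl => v; rewrite 1?andbC // andb_idr // => vU.
by apply/asboolP; left.
Qed.

(** The part of the chain weight that values on [U] cannot change. The division undoes the boundary
    activities contained in [lam_wt]. *)
Definition boundary_factor (U : {fset site r}) s b : R :=
  (\prod_(v <- s | v \in U) (if v == root r then edge_total^-1 else 1)) *
  (\prod_(v <- s | v \notin U) site_wt s v (b v)) *
  (all (fun v => [|| v == root r, v \in U, pa v \in U | h (b (pa v)) (b v)]) s)%:R /
  \prod_(v <- s | (v \notin U) && `[< Uplus U v >]) lam (b v).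

(** The finite form of the Gibbs property: with the outside values fixed, the chain weight is
    proportional to [lam_wt]. Sites of [U] have all neighbours in [s], so [site_wt_inner] turns
    their weights into activities. *)
Lemma chain_wt_glue (U : {fset site r}) s b (xi : {ffun U -> 'I_n.+1}) : grow s ->
  (forall v, Uplus U v -> v \in s) ->
  chain_wt site_law (fun i j => edge_law i j / site_law i) s (glue xi b) =
  boundary_factor U s b * lam_wt h lam U (glue xi b).
Proof.
move=> gs Us; rewrite chain_wt_sites // (hom_on_glue _ gs Us).
rewrite (lam_wt_list _ (grow_uniq gs) Us) /boundary_factor.
have gU v : v \notin U -> glue xi b v = b v by move=> vU; rewrite glue_notin.
have -> : all (fun v => [|| v == root r, v \in U, pa v \in U |
      h (glue xi b (pa v)) (glue xi b v)]) s =
  all (fun v => [|| v == root r, v \in U, pa v \in U | h (b (pa v)) (b v)]) s.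
  apply: eq_all => v; case: eqP => //= _; case: (boolP (v \in U)) => //= vU.
  by case: (boolP (pa v \in U)) => //= pU; rewrite !gU.
set allb := all _ s.
rewrite (bigID (fun v => v \in U)) /=.
have -> : \prod_(v <- s | v \in U) site_wt s v (glue xi b v) =
    (\prod_(v <- s | v \in U) lam (glue xi b v)) *
    \prod_(v <- s | v \in U) (if v == root r then edge_total^-1 else 1).
  rewrite -big_split; apply: eq_bigr => v vU; apply: site_wt_inner => // x vx.
  apply: Us; case: (boolP (x \in U)) => xU; first by left.
  by right; split=> //; exists v.
have -> : \prod_(v <- s | v \notin U) site_wt s v (glue xi b v) =
    \prod_(v <- s | v \notin U) site_wt s v (b v).
  by apply: eq_bigr => v vU; rewrite gU.
have -> : \prod_(v <- s | (v \notin U) && `[< Uplus U v >]) lam (glue xi b v) =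
    \prod_(v <- s | (v \notin U) && `[< Uplus U v >]) lam (b v).
  by apply: eq_bigr => v /andP[vU _]; rewrite gU.
have : \prod_(v <- s | (v \notin U) && `[< Uplus U v >]) lam (b v) != 0.
  by rewrite gt_eqF //; apply: prodr_gt0.
move: (\prod_(v <- s | _ && _) _) => d d0.
by rewrite -mulnb natrM; field.
Qed.

End GibbsWeights.

(** * Measures given by a density *)

Section IntegralMeasure.
Context d (T : measurableType d) (R : realType) (mu : {measure set T -> \bar R}).
Variable f : T -> R.
Hypotheses (mf : measurable_fun setT f) (f0 : forall x, 0 <= f x).

(** The right side of the Gibbs condition as a measure in the conditioning event, so that cylinders
    suffice there too. *)
Definition density (B : set T) : \bar R := (\int[mu]_(x in B) (f x)%:E)%E.

Let density0 : density set0 = 0%E.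
Proof. exact: integral_set0. Qed.

Let density_ge0 B : (0 <= density B)%E.
Proof. by apply: integral_ge0 => x _; rewrite lee_fin. Qed.

Let density_sigma_additive : semi_sigma_additive density.
Proof.
move=> F mF tF mUF; rewrite /density; apply: cvg_toP.
  apply: ereal_nondecreasing_is_cvgn => m n mn.
  by apply: lee_sum_nneg_natr => // k _ _; exact: density_ge0.
rewrite ge0_integral_bigcup //.
- apply: (measurable_funS measurableT (@subsetT _ _)); exact: measurableT_comp.
- by move=> x _; rewrite lee_fin.
Qed.

HB.instance Definition _ := isMeasure.Build _ _ _ density
  density0 density_ge0 density_sigma_additive.

Definition density_measure : {measure set T -> \bar R} := density.

End IntegralMeasure.

(** * Locality and measurability of the conditional probabilities *)

Section LambdaConditional.
Variables (R : realType) (r n : nat) (h : rel 'I_n.+1) (lam : 'I_n.+1 -> R).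
Hypothesis l0 : forall i, 0 < lam i.
Implicit Types (a b : site r -> 'I_n.+1) (u v : site r) (s : seq (site r)).

Lemma Uplus_cover (U : {fset site r}) :
  exists s : seq (site r), forall v, Uplus U v -> v \in s.
Proof.
exists (U ++ [seq nbr u c | u <- U, c <- enum 'I_r.+1]) => v [vU|[_ [u uU]]].
  by rewrite mem_cat; apply/orP; left.
move=> /tadjP[c ->]; rewrite mem_cat; apply/orP; right.
by apply/allpairsP; exists (u, c); rewrite /= mem_enum.
Qed.

Lemma eq_lam_wt (U : {fset site r}) a b : (forall v, Uplus U v -> a v = b v) ->
  lam_wt h lam U a = lam_wt h lam U b.
Proof.
move=> ab; rewrite /lam_wt; congr (_ * _).
  congr (if _ then _ else _); apply/asboolP/asboolP => H u v Uu Uv uv.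
    by rewrite -!ab // H.
  by rewrite !ab // H.
by apply: eq_fsbigr => v /set_mem Uv; rewrite ab.
Qed.

Lemma lam_wt_ge0 (U : {fset site r}) a : 0 <= lam_wt h lam U a.
Proof.
rewrite /lam_wt mulr_ge0 //; first by case: ifP.
by apply: prodr_ge0 => v _; exact: ltW.
Qed.

Lemma lam_cond_ge0 (U : {fset site r}) (eta : {ffun U -> 'I_n.+1}) a :
  0 <= lam_cond h lam eta a.
Proof.
by rewrite divr_ge0 ?lam_wt_ge0 // sumr_ge0 // => xi _; exact: lam_wt_ge0.
Qed.

Lemma eq_lam_cond (U : {fset site r}) (eta : {ffun U -> 'I_n.+1}) a b :
  (forall v, bdry U v -> a v = b v) -> lam_cond h lam eta a = lam_cond h lam eta b.
Proof.
move=> ab; have gab (xi : {ffun U -> 'I_n.+1}) :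
    lam_wt h lam U (glue xi a) = lam_wt h lam U (glue xi b).
  apply: eq_lam_wt => v Uv; case: (boolP (v \in U)) => vU.
    by rewrite -[v]/(val [` vU]%fset) !glue_in.
  by rewrite !glue_notin // ab //; case: Uv => // Uv; case/negP: vU.
by rewrite /lam_cond gab; congr (_ / _); apply: eq_bigr => xi _; exact: gab.
Qed.

Lemma measurable_lam_cond (U : {fset site r}) (eta : {ffun U -> 'I_n.+1}) :
  measurable_fun [set: Cfg r n] (lam_cond h lam eta : Cfg r n -> R).
Proof.
move=> _ Y mY; rewrite setTI; have [s Us] := Uplus_cover U.
apply: (@determined_measurable _ _ [fset v in s]%fset) => phi psi E /= Yphi.
rewrite -(eq_lam_cond _ (a := phi)) // => v Uv; apply: E.
by rewrite inE /=; apply: Us; right.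
Qed.

End LambdaConditional.

(** * Homomorphisms as the complement of countably many bad edges *)

Section Homset.
Variables (r n : nat) (h : rel 'I_n.+1).

Definition bad_edge (uv : site r * site r) : set (Cfg r n) :=
  [set phi | tadj uv.1 uv.2 /\ ~~ h (phi uv.1) (phi uv.2)].

Definition bad_edges : set (Cfg r n) :=
  \bigcup_k (if choice.unpickle k is Some uv then bad_edge uv else set0).

Lemma measurable_bad_edge uv : measurable (bad_edge uv).
Proof.
apply: (@determined_measurable _ _ [fset uv.1; uv.2]%fset) => phi psi E [uvA].
by rewrite !E ?inE ?eqxx ?orbT.
Qed.

Lemma measurable_bad_edges : measurable bad_edges.
Proof.
apply: bigcupT_measurable => k; case: (choice.unpickle k) => [uv|] //.
exact: measurable_bad_edge.
Qed.

Lemma homsetE : homset h = ~` bad_edges.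
Proof.
apply/seteqP; split=> phi.
  move=> hphi [k _]; case: (choice.unpickle k) => // uv [t /negP]; apply.
  exact: hphi.
move=> nb u v t; apply/negPn/negP => hn; apply: nb.
by exists (choice.pickle (u, v)) => //; rewrite choice.pickleK.
Qed.

Lemma measurable_homset : measurable (homset h : set (Cfg r n)).
Proof. by rewrite homsetE; apply: measurableC; exact: measurable_bad_edges. Qed.

End Homset.

(** * The chain is a Gibbs measure *)

Section ChainGibbs.
Variables (R : realType) (r n : nat) (h : rel 'I_n.+1).
Variables (w lam : 'I_n.+1 -> R).
Hypotheses (hS : symmetric h) (w0 : forall i, 0 < w i) (l0 : forall i, 0 < lam i).
Hypothesis z0 : forall i, 0 < nsum h w i.
Hypothesis wE : forall i, w i = lam i * nsum h w i ^+ r.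
Variable mu : probability (Cfg r n) R.
Notation M := (edge_law h w).
Notation pi := (site_law h w).
Hypothesis muE : forall s (a : site r -> 'I_n.+1), grow s ->
  mu (cyl s a) = (chain_wt pi (fun i j => M i j / pi i) s a)%:E.
Implicit Types (a b : site r -> 'I_n.+1) (u v : site r) (s : seq (site r)).
Notation at_site u i := [set phi : Cfg r n | phi u = i].

Lemma chain_homset : mu (homset h) = 1%E.
Proof.
have pi0 i : 0 < pi i by exact: site_law_gt0.
have edge u v i j : tadj u v -> pr mu (at_site u i `&` at_site v j) = M i j.
  exact: (chain_edge pi0 (site_lawE h w) (edge_lawC w hS) muE).
have bad0 uv : mu (bad_edge h uv) = 0%E.
  have mb0 := measurable_bad_edge h uv.
  rewrite prE // (pr_site_split mu uv.1) // big1 // => i _.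
  have mb : measurable (at_site uv.1 i `&` bad_edge h uv).
    by apply: measurableI; [exact: measurable_coord|exact: measurable_bad_edge].
  rewrite (pr_site_split mu uv.2) // big1 // => j _; apply/eqP.
  rewrite eq_le pr_ge0 andbT.
  case: (boolP (tadj uv.1 uv.2 && ~~ h i j)) => [/andP[t hij]|tn].
    have <- : M i j = 0 by rewrite /edge_law (negbTE hij).
    rewrite -(edge _ _ i j t); apply: le_pr; rewrite //.
    - by apply: measurableI => //; exact: measurable_coord.
    - by apply: measurableI; exact: measurable_coord.
    - by move=> phi [pj [pi' _]].
  rewrite (_ : _ `&` _ = set0) ?/pr ?measure0 //.
  apply/seteqP; split=> // phi [pj [pi' [t]]]; rewrite pi' pj => hij.
  by move: tn; rewrite t hij.
rewrite homsetE probability_setC //; last exact: measurable_bad_edges.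
rewrite (_ : mu _ = 0%E) ?sube0 //.
apply/negligibleP; first exact: measurable_bad_edges.
apply: negligible_bigcup => k.
case: (choice.unpickle k) => [uv|]; last exact: negligible_set0.
by apply/negligibleP; [exact: measurable_bad_edge|exact: bad0].
Qed.

(** It is enough to test cylinders over [V'], a grown list covering [Uplus U] with [U] removed.
    There the boundary is fixed, the conditional probability is constant, and [chain_wt_glue]
    reduces the claim to normalisation. *)
Lemma chain_gibbs : is_gibbs h lam mu.
Proof.
split; first exact: chain_homset.
move=> U eta B sB; pose E : set (Cfg r n) :=
  [set phi | forall u : U, phi (val u) = eta u].
pose c0 : site r -> 'I_n.+1 := fun=> ord0.
have EE : E = cyl U (glue eta c0).
  apply/seteqP; split=> phi pE.
    by move=> v vU; rewrite -[v]/(val [` vU]%fset) glue_in pE.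
  by move=> u; rewrite -(glue_in eta c0) pE // (valP u).
have mE : measurable E by rewrite EE; exact: measurable_cyl.
pose f : Cfg r n -> R := lam_cond h lam eta.
have mf : measurable_fun [set: Cfg r n] f by exact: measurable_lam_cond.
have f0 phi : 0 <= f phi by exact: lam_cond_ge0.
rewrite -/E setIC -[LHS]/(mrestr mu mE B) -[RHS]/(density_measure mu mf f0 B).
apply: cyl_measure_eq sB.
  rewrite [X in (X < _)%E](_ : _ = mu (setT `&` E)) // prE ?ltry //.
  exact: measurableI.
move=> V VU; have [t Ut] := Uplus_cover U.
have [s gs ss] := grow_cover (V ++ t).
have Us v : Uplus U v -> v \in s by move/Ut => vt; apply: ss; rewrite mem_cat vt orbT.
pose V' := [seq v <- s | v \notin U].
have V'E v : (v \in V') = (v \notin U) && (v \in s) by rewrite mem_filter.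
exists V'; split=> [v vV|v|b].
- by rewrite V'E ss ?mem_cat ?vV // andbT; apply/negP/VU.
- by rewrite V'E => /andP[/negP].
have UV' v : v \in U -> v \notin V' by rewrite V'E => ->.
have UV's : U ++ V' =i s.
  move=> v; rewrite mem_cat V'E; case: (boolP (v \in U)) => //= vU.
  by apply/esym/Us; left.
have cE xi : cyl (U ++ V') (glue xi b) = cyl s (glue xi b) by exact: eq_cyl.
rewrite [LHS](_ : _ = mu (cyl s (glue eta b))); last first.
  rewrite -cE cyl_cat setIC -[LHS]/(mu (cyl V' b `&` E)) EE.
  congr (mu (_ `&` _)); apply: eq_cyl => // v vV.
    by rewrite glue_notin //; move: vV; rewrite V'E => /andP[].
  by rewrite -[v]/(val [` vV]%fset) !glue_in.
rewrite muE // (chain_wt_glue hS w0 l0 z0 wE b eta gs Us).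
rewrite [RHS](_ : _ = \int[mu]_(x in cyl V' b) (lam_cond h lam eta b)%:E)%E; last first.
  apply: eq_integral => phi /set_mem pV; congr _%:E; apply: eq_lam_cond => v Uv.
  by apply: pV; rewrite V'E Us ?andbT; [case: Uv|right].
transitivity ((lam_cond h lam eta b)%:E * mu (cyl V' b))%E; last first.
  by rewrite integral_cst //; exact: measurable_cyl.
rewrite (prob_cyl_marginal _ _ UV').
under eq_bigr do rewrite cE muE // (chain_wt_glue hS w0 l0 z0 wE b _ gs Us).
rewrite sumEFin -EFinM -mulr_sumr; congr _%:E; rewrite /lam_cond.
set S := \sum_(xi : {ffun U -> 'I_n.+1}) _; set K := boundary_factor _ _ _ _ _ _.
(* For boundary values without extension to [U] the quotient is 0 by convention; the weight at [eta]
   is then 0 as a term of a vanishing sum of nonnegative terms. *)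
have [S0|S0] := eqVneq S 0; last by rewrite [RHS]mulrCA divfK.
rewrite S0 invr0 mulr0 mul0r; apply/eqP; rewrite mulf_eq0; apply/orP; right.
move: S0 => /eqP; rewrite psumr_eq0 => [/allP /(_ eta)|xi _]; last exact: lam_wt_ge0.
by rewrite mem_index_enum => /(_ isT).
Qed.

End ChainGibbs.

(** * Uniqueness *)

Section EdgeLawWeights.
Variables (R : realType) (r n : nat) (h : rel 'I_n.+1).
Variables (lam pi c : 'I_n.+1 -> R) (M : 'I_n.+1 -> 'I_n.+1 -> R).
Hypotheses (hS : symmetric h) (hC : forall i j, connect h i j).
Hypothesis hN : forall i, exists j, h i j.
Hypothesis l0 : forall i, 0 < lam i.
Hypotheses (M0 : forall i j, 0 <= M i j) (MC : forall i j, M i j = M j i).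
Hypothesis Mh : forall i j, ~~ h i j -> M i j = 0.
Hypotheses (piE : forall i, pi i = \sum_j M i j) (pi1 : \sum_i pi i = 1).
Hypothesis star : forall i j, h i j -> pi i * (M i j / pi i) ^+ r.+1 = lam i * c j.

Lemma root_exists (x : R) k : 0 < x -> exists2 y : R, 0 < y & y ^+ k.+1 = x.
Proof.
move=> x0; exists (x `^ (k.+1%:R^-1)); first exact: powR_gt0.
by rewrite -powR_mulrn ?powR_ge0 // -powRrM mulVf ?powRr1 // ltW.
Qed.

Lemma nsum_gt0 (g : 'I_n.+1 -> R) i : (forall j, 0 < g j) -> 0 < nsum h g i.
Proof.
move=> g0; have [j hij] := hN i; apply: lt_le_trans (g0 j) (le_nsum _ hij) => k.
exact: ltW.
Qed.

(** If [pi j > 0], some [M j k] is positive, and [star] for the edge from [k] to [j] gives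
    [c j > 0]. Then [star] makes [M i j] positive for every neighbour [i], so [pi i > 0], and
    positivity spreads by connectedness. *)
Lemma edge_law_pos : (forall i, 0 < c i) /\ (forall i j, h i j -> 0 < M i j).
Proof.
have piM i j : M i j <= pi i by rewrite piE (bigD1 j) //= lerDl sumr_ge0.
have pi0 i : 0 <= pi i by rewrite piE sumr_ge0.
have key j : 0 < pi j -> 0 < c j /\ forall i, h i j -> 0 < M i j.
  move=> pj; have [k Mjk] : exists k, 0 < M j k.
    apply/existsP; rewrite -[X in is_true X]negbK negb_exists; apply/negP => /forallP H.
    move: pj; rewrite piE big1 ?ltxx // => k _; apply/eqP.
    by rewrite eq_le M0 andbT leNgt; exact: H.
  have hkj : h k j.
    by rewrite hS; apply/negPn/negP => /Mh E; rewrite E ltxx in Mjk.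
  have cj : 0 < c j.
    have pk : 0 < pi k by apply: lt_le_trans (piM k j); rewrite MC.
    rewrite -(pmulr_rgt0 _ (l0 k)) -star // mulr_gt0 // exprn_gt0 // divr_gt0 //.
    by rewrite MC.
  split=> // i hij; rewrite lt_neqAle M0 andbT eq_sym; apply/eqP => Mij.
  have := star hij; rewrite Mij mul0r expr0n /= mulr0 => /esym/eqP.
  by rewrite mulf_eq0 !gt_eqF.
have piall j : 0 < pi j.
  have [k pk] : exists k, 0 < pi k.
    apply/existsP; rewrite -[X in is_true X]negbK negb_exists; apply/negP => /forallP H.
    have := pi1; rewrite big1 => [/esym/eqP|k _]; first by rewrite oner_eq0.
    by apply/eqP; rewrite eq_le pi0 andbT leNgt; exact: H.
  have /connectP[p pp ->] := hC k j.
  elim: p k pk pp => //= l p IHp k pk /andP[hkl pp]; apply: IHp pp.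
  apply: lt_le_trans (piM l k); have [_] := key k pk; apply.
  by rewrite hS.
split=> [i|i j hij]; first by case: (key i (piall i)).
by have [_] := key j (piall j); apply.
Qed.

(* With [f i ^+ r.+1 = pi i / lam i] and [g j ^+ r.+1 = c j], [star] says that
   the transition probability from [i] to [j] is [g j / f i]. *)
Lemma edge_law_weights : exists g kap, [/\ forall i, 0 < g i, 0 < kap,
  forall i, g i = kap * lam i * nsum h g i ^+ r &
  forall i j, M i j = edge_law h g i j].
Proof.
have [c0 Mpos] := edge_law_pos.
have pi0 i : 0 < pi i.
  have [j hij] := hN i; apply: lt_le_trans (Mpos _ _ hij) _.
  by rewrite piE (bigD1 j) //= lerDl sumr_ge0.
have fex i : exists y, (0 < y) && (y ^+ r.+1 == pi i / lam i).
  have [y y0 yE] := @root_exists (pi i / lam i) r (divr_gt0 (pi0 i) (l0 i)).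
  by exists y; rewrite y0 yE eqxx.
have gex i : exists y, (0 < y) && (y ^+ r.+1 == c i).
  by have [y y0 yE] := @root_exists (c i) r (c0 i); exists y; rewrite y0 yE eqxx.
pose f i := xchoose (fex i); pose g i := xchoose (gex i).
have [f0 fE] : (forall i, 0 < f i) /\ forall i, f i ^+ r.+1 = pi i / lam i.
  by split=> i; have /andP[H1 /eqP H2] := xchooseP (fex i).
have [g0 gE] : (forall i, 0 < g i) /\ forall i, g i ^+ r.+1 = c i.
  by split=> i; have /andP[H1 /eqP H2] := xchooseP (gex i).
have fg i j : h i j -> M i j = pi i / f i * g j.
  move=> hij; have E : f i * (M i j / pi i) = g j.
    have P0 : 0 <= M i j / pi i by rewrite divr_ge0 // ltW.
    apply/eqP; rewrite -(@eqrXn2 _ r.+1) //; last exact: ltW.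
      by rewrite gE exprMn fE mulrAC star // mulrC (mulKf (lt0r_neq0 (l0 i))).
    by rewrite mulr_ge0 // ltW.
  by rewrite -E; field; rewrite !gt_eqF.
pose x i := pi i / f i; pose kap := x ord0 / g ord0.
have x0 i : 0 < x i by rewrite divr_gt0.
(* Symmetry of [M] equates [x i * g j] and [x j * g i], so [x / g] is constant on the connected
   graph. *)
have ratio i j : h i j -> x i / g i = x j / g j.
  move=> hij; apply/eqP; rewrite eqr_div ?(lt0r_neq0 (g0 _)) //; apply/eqP.
  have hji : h j i by rewrite hS.
  by rewrite /x -(fg i j hij) -(fg j i hji) MC.
have xE i : x i = kap * g i.
  rewrite /kap; have -> : x ord0 / g ord0 = x i / g i.
    have /connectP[p pp ->] := hC ord0 i.
    elim: p (ord0 : 'I_n.+1) pp => //= k p IHp j /andP[hjk /IHp <-].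
    exact: ratio.
  by rewrite divfK // gt_eqF.
have k0 : 0 < kap by rewrite divr_gt0.
have ME i j : h i j -> M i j = kap * g i * g j by move=> hij; rewrite fg // -/(x i) xE.
have piG i : pi i = kap * g i * nsum h g i.
  rewrite piE (bigID (h i)) /= [X in _ + X]big1 ?addr0 => [|j /Mh //].
  by rewrite mulr_sumr; apply: eq_bigr => j hij; exact: ME.
(* Transition probabilities [g j / f i] out of [i] sum to 1. *)
have fn i : f i = nsum h g i.
  have : x i * f i = pi i by rewrite divfK // gt_eqF.
  rewrite piG xE => /mulfI; apply; by rewrite mulf_neq0 // gt_eqF.
have kT : kap * edge_total h g = 1.
  by rewrite /edge_total mulr_sumr -pi1; apply: eq_bigr => i _; rewrite piG mulrA.
(* [pi i = lam i * f i ^+ r.+1], compared with [pi i = kap * g i * nsum h g i], gives the weight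
   equation with constant [kap^-1]. *)
exists g, kap^-1; split=> // [|i|i j].
- by rewrite invr_gt0.
- have n0 : nsum h g i != 0 by rewrite gt_eqF // nsum_gt0.
  have := fE i; rewrite fn piG exprS => E.
  have E2 : lam i * (nsum h g i * nsum h g i ^+ r) = kap * g i * nsum h g i.
    by rewrite E mulrC divfK // gt_eqF.
  rewrite -mulrA; apply: (mulfI (lt0r_neq0 k0)); rewrite mulVKf ?gt_eqF //.
  by apply: (mulIf n0); rewrite -E2; ring.
- rewrite /edge_law; case: ifPn => [hij|/Mh //]; rewrite ME //.
  have t0 : edge_total h g != 0.
    by apply/lt0r_neq0/edge_total_gt0 => // k; exact: nsum_gt0.
  have -> : kap = (edge_total h g)^-1 by apply: (mulIf t0); rewrite kT mulVf.
  by rewrite -mulrA mulrC.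
Qed.

End EdgeLawWeights.

Lemma edge_law_scale (R : realType) (n : nat) (h : rel 'I_n.+1) (w g : 'I_n.+1 -> R) k :
  0 < k -> (forall i, g i = k * w i) -> edge_law h g =2 edge_law h w.
Proof.
move=> k0 gE; have nE i : nsum h g i = k * nsum h w i.
  by rewrite /nsum mulr_sumr; apply: eq_bigr.
have tE : edge_total h g = k ^+ 2 * edge_total h w.
  rewrite /edge_total mulr_sumr; apply: eq_bigr => i _; rewrite gE nE; ring.
move=> i j; rewrite /edge_law; case: ifP => // _; rewrite tE !gE invfM.
have -> : k * w i * (k * w j) = k ^+ 2 * (w i * w j) by ring.
by rewrite mulrACA mulfV ?mul1r // expf_neq0 // gt_eqF.
Qed.

(** * The Gibbs condition at one site *)

Section GibbsStar.
Variables (R : realType) (r n : nat) (h : rel 'I_n.+1) (lam : 'I_n.+1 -> R).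
Hypotheses (hS : symmetric h) (l0 : forall i, 0 < lam i).
Variables (nu : probability (Cfg r n) R) (pi : 'I_n.+1 -> R) (M : 'I_n.+1 -> 'I_n.+1 -> R).
Hypothesis nuG : is_gibbs h lam nu.
Hypothesis nuF : forall s (a : site r -> 'I_n.+1), grow s ->
  nu (cyl s a) = (chain_wt pi (fun i j => M i j / pi i) s a)%:E.

Definition star_sites : seq (site r) := [seq ext (root r) c | c <- enum 'I_r.+1].

Lemma star_sitesP v : reflect (v != root r /\ pa v = root r) (v \in star_sites).
Proof.
apply: (iffP mapP) => [[c _ ->]|[v0 pv]].
  by rewrite ext_neq_root ?pa_ext.
by exists (last ord0 (val v)); rewrite ?mem_enum // -pv ext_pa.
Qed.

Lemma grow_star : grow (star_sites ++ [:: root r]).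
Proof.
rewrite /star_sites; have : uniq (enum 'I_r.+1) by exact: enum_uniq.
elim: (enum _) => [_|c t IHt /= /andP[ct /IHt ->]]; first by apply/and3P; rewrite eqxx.
rewrite pa_ext // mem_cat mem_seq1 negb_or ext_neq_root // andbT /=.
rewrite mem_cat mem_seq1 eqxx !orbT andbT; apply: contra ct => /mapP[d dt].
by move/(congr1 val); rewrite !val_ext // => -[->].
Qed.

Lemma Uplus_root v : Uplus [fset root r]%fset v <-> v \in star_sites ++ [:: root r].
Proof.
rewrite mem_cat mem_seq1; split.
  case=> [|[_ [u]]]; first by rewrite /= inE => ->; rewrite orbT.
  rewrite inE => /eqP-> ; rewrite tadjE eqxx /= orbF => /andP[v0 /eqP pv].
  by apply/orP; left; apply/star_sitesP.
case/orP => [/star_sitesP[v0 pv]|/eqP->]; last by left; rewrite /= inE.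
right; split; first by rewrite inE.
by exists (root r); rewrite ?inE // tadjE v0 pv eqxx.
Qed.

(** The left side is the probability of [i] at the root and [j] at all [r.+1] neighbours. The Gibbs
    condition at the root writes it as the probability of the neighbours' values times a conditional
    probability in which only the factor [lam i] depends on [i]. *)
Lemma gibbs_star j : exists c, forall i, h i j ->
  pi i * (M i j / pi i) ^+ r.+1 = lam i * c.
Proof.
pose U : {fset site r} := [fset root r]%fset; pose b : site r -> 'I_n.+1 := fun=> j.
pose s := star_sites ++ [:: root r].
have us : uniq s := grow_uniq grow_star.
have Us v : Uplus U v -> v \in s by move/Uplus_root.
have srt : root r \notin star_sites by apply/negP => /star_sitesP[]; rewrite eqxx.
pose D := \prod_(v <- s | (v \notin U) && `[< Uplus U v >]) lam (b v).
pose B := cyl star_sites b.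
have rU : root r \in U by rewrite inE.
pose S := \sum_(xi : {ffun U -> 'I_n.+1}) lam_wt h lam U (glue xi b).
exists (D / S * pr nu B) => i hij.
pose eta : {ffun U -> 'I_n.+1} := [ffun=> i].
have er : glue eta b (root r) = i by rewrite -[root r]/(val [` rU]%fset) glue_in ffunE.
have es v : v != root r -> glue eta b v = j by move=> v0; rewrite glue_notin // inE.
have ho : hom_on h U (glue eta b).
  move=> u v /Uplus_root + /Uplus_root.
  have sE x : (x \in s) -> x == root r \/ x != root r /\ pa x = root r.
    by rewrite mem_cat mem_seq1 => /orP[/star_sitesP|]; [right|left].
  move=> /sE uU /sE vU; rewrite tadjE => /orP[] /andP[x0 /eqP xE].
    case: vU => [vr|[_ pv]]; first by rewrite vr in x0.
    by rewrite xE pv er es.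
  case: uU => [ur|[_ pu]]; first by rewrite ur in x0.
  by rewrite xE pu er es // hS.
have lw : lam_wt h lam U (glue eta b) = lam i * D.
  rewrite (lam_wt_list _ _ _ us Us) asboolT // mul1r; congr (_ * _).
    rewrite (eq_bigl (pred1 (root r))) => [|v]; last by rewrite inE.
    by rewrite -big_filter filter_pred1_uniq // ?mem_cat ?mem_seq1 ?eqxx ?orbT // big_seq1 er.
  by apply: eq_bigr => v /andP[vU _]; rewrite glue_notin.
have := (nuG.2 U eta B); rewrite /B => /(_ _) H.
have {}H : nu (cyl s (glue eta b)) = ((lam_cond h lam eta b)%:E * nu B)%E.
  transitivity (nu ([set phi : Cfg r n | forall u : U, phi (val u) = eta u] `&` B)).
    congr (nu _); rewrite /s cyl_cat setIC; congr (_ `&` _).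
      apply/seteqP; split=> phi pE.
        move=> u; have -> : u = [` rU]%fset.
          by apply: val_inj; have := valP u; rewrite inE => /eqP.
        by rewrite ffunE /= pE ?mem_seq1 // er.
      move=> v; rewrite mem_seq1 => /eqP->; rewrite er.
      by have := pE [` rU]%fset; rewrite ffunE.
    by apply: eq_cyl => // v vs; rewrite es //; case/star_sitesP: vs.
  rewrite H; last first.
    apply: cyl_sigma => v vs; rewrite /= inE => vr; move: vs.
    by rewrite (eqP vr) (negbTE srt).
  transitivity (\int[nu]_(x in cyl star_sites b) (lam_cond h lam eta b)%:E)%E.
    apply: eq_integral => phi /set_mem pB; congr _%:E; apply: eq_lam_cond => v Uv.
    apply: pB; have : v \in s by apply: Us; right.
    rewrite mem_cat mem_seq1 => /orP[//|/eqP vr].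
    by case: Uv => /negP[]; rewrite vr.
  by rewrite integral_cst //; exact: measurable_cyl.
move: H; rewrite nuF ?grow_star // prE; last exact: measurable_cyl.
rewrite -EFinM => -[]; rewrite /lam_cond lw -/S => E.
transitivity (chain_wt pi (fun i j => M i j / pi i) s (glue eta b)).
  rewrite /chain_wt /s big_cat big_seq1 /= mulrC /step_wt eqxx er; congr (_ * _).
  rewrite big_map (eq_bigr (fun=> M i j / pi i)) => [|c _].
    by rewrite big_const_seq count_predT size_enum_ord iter_mulr_1.
  by rewrite (negbTE (ext_neq_root _)) // pa_ext // er es // ext_neq_root.
by rewrite E -!mulrA.
Qed.

End GibbsStar.

Lemma has_neighbor (n : nat) (h : rel 'I_n.+1) : symmetric h ->
  (forall i j, connect h i j) -> (exists i j, h i j) -> forall i, exists j, h i j.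
Proof.
move=> hS hC [a [b hab]] i; have [->|ia] := eqVneq i a; first by exists b.
have /connectP[[|k p] /= pp E] := hC i a; first by rewrite E eqxx in ia.
by case/andP: pp => hik _; exists k.
Qed.

Theorem theorem5p4 (R : realType) (r n : nat) (h : rel 'I_n.+1) :
  (1 <= r)%N -> symmetric h -> (forall i j, connect h i j) ->
  (exists i j, h i j) ->
  exists lam : 'I_n.+1 -> R, (forall i, 0 < lam i) /\
    exists mu : probability (Cfg r n) R,
      (is_gibbs h lam mu /\ is_simple mu /\ is_invariant mu) /\
      forall nu : probability (Cfg r n) R,
        is_gibbs h lam nu /\ is_simple nu /\ is_invariant nu ->
        forall A : set (Cfg r n), measurable A -> nu A = mu A.
Proof.
move=> r1 hS hC hE; have hN := has_neighbor hS hC hE.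
have [lam [w [l0 w0 wE wU]]] := unique_weights R r1 hS hC hE.
exists lam; split=> //.
have z0 i : 0 < nsum h w i by exact: nsum_gt0.
pose pi := site_law h w; pose M := edge_law h w.
have pi0 i : 0 < pi i by exact: site_law_gt0.
have [mu muE] : exists mu : probability (Cfg r n) R, forall s a, grow s ->
    mu (cyl s a) = (chain_wt pi (fun i j => M i j / pi i) s a)%:E.
  apply: chain_exists => // [i||i j|i].
  - exact: ltW.
  - exact: site_law_sum.
  - by apply: divr_ge0; [exact: edge_law_ge0|exact: ltW].
  - by rewrite -mulr_suml -site_lawE divff // gt_eqF // pi0.
exists mu; split.
  split; first exact: (chain_gibbs hS w0 l0 z0 wE muE).
  split; first exact: chain_simple muE.
  exact: (chain_invariant pi0 (site_lawE h w) (edge_lawC w hS) muE).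
move=> nu [nuG [nuS nuI]].
pose e := ext (root r) (ord0 : 'I_r.+1).
have re : tadj (root r) e by rewrite tadjE ext_neq_root // pa_ext // eqxx.
pose N i j := pr nu ([set phi : Cfg r n | phi (root r) = i] `&` [set phi | phi e = j]).
pose q i := pr nu [set phi : Cfg r n | phi (root r) = i].
have mS v i : measurable ([set phi | phi v = i] : set (Cfg r n)).
  exact: measurable_coord.
(* Invariance and transitivity on oriented edges reduce every edge law to that of one edge; its
   reversal gives the symmetry of [N]. *)
have nuN u v i j : tadj u v ->
    pr nu ([set phi : Cfg r n | phi u = i] `&` [set phi | phi v = j]) = N i j.
  move=> /tree_aut_edge[g [ga gu gv]]; rewrite /N /pr -[in RHS](nuI g ga).
    by congr (fine (nu _)); rewrite -gu -gv.
  by apply: measurableI.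
have NC i j : N i j = N j i by rewrite -(nuN e (root r)) 1?tadjC // setIC.
have nuq v i : pr nu [set phi : Cfg r n | phi v = i] = q i.
  have [g [ga gu gv]] : exists g, [/\ tree_aut g, g (root r) = v & g e = nbr v ord0].
    by apply: tree_aut_edge; apply/tadjP; exists ord0.
  rewrite /q /pr -[in RHS](nuI g ga) //.
  by congr (fine (nu _)); rewrite -gu.
have nuF s a : grow s -> nu (cyl s a) = (chain_wt q (fun i j => N i j / q i) s a)%:E.
  by apply: (simple_chain nuS nuq) => v i j v0; apply: nuN; exact: tadj_pa.
have qE i : q i = \sum_j N i j.
  by rewrite /q (pr_site_split nu e) //; apply: eq_bigr => j _; rewrite setIC.
have q1 : \sum_i q i = 1.
  have pT : pr nu setT = 1 by rewrite /pr probability_setT.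
  rewrite -[RHS]pT (pr_site_split nu (root r) measurableT).
  by apply: eq_bigr => i _; rewrite setIT.
have Nh i j : ~~ h i j -> N i j = 0.
  move=> hij; apply/eqP; rewrite eq_le pr_ge0 andbT.
  have mH : measurable (homset h : set (Cfg r n)) by exact: measurable_homset.
  have <- : pr nu (~` homset h) = 0.
    by rewrite /pr probability_setC // nuG.1 subee.
  apply: le_pr; [exact: measurableI|exact: measurableC|].
  by move=> phi [pr' pe] hphi; have := hphi _ _ re; rewrite pr' pe (negbTE hij).
have cex j : exists c, forall i, h i j -> q i * (N i j / q i) ^+ r.+1 = lam i * c.
  exact: (gibbs_star hS nuG nuF).
(* [gibbs_star] gives a constant for each [j] separately; they are chosen here as one function. *)
pose c j := xget 0 [set c | forall i, h i j -> q i * (N i j / q i) ^+ r.+1 = lam i * c].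
have cE i j : h i j -> q i * (N i j / q i) ^+ r.+1 = lam i * c j.
  move=> hij; have [c0 c0P] := cex j.
  by have := xgetPex 0 (ex_intro (fun c => forall i, h i j -> _) c0 c0P); apply.
have [g [kap [g0 k0 gE NE]]] := edge_law_weights hS hC hN l0
  (fun i j => pr_ge0 _ _) NC Nh qE q1 cE.
(* The special choice of [lam] enters here: the weights of [nu] are those of [mu] up to a factor, to
   which the edge law is insensitive. *)
have [k kp gw] := wU g kap k0 g0 gE.
have NM i j : N i j = M i j by rewrite /M -(edge_law_scale h kp gw); exact: NE.
have qpi i : q i = pi i by rewrite qE /pi site_lawE; apply: eq_bigr => j _.
apply: chain_measure_unique => s a gs; rewrite nuF // muE //; congr _%:E.
by apply: eq_bigr => v _; rewrite /step_wt qpi NM qpi.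
Qed.
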